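(* For a random variable $F\in L^2_{\mathbb{X}}$ the following conditions are equivalent: (i) $F\in\operatorname{dom}(D)$. (ii) $(D_kF)_{k\in\mathbb{N}}\in L^2(\kappa\otimes\mathbb{P}_{\mathcal F})$, i.e. $\sum_{k=1}^\infty\mathbb{E}[(D_kF)^2]<\infty$. (iii) For one (and then every) representative $f\in L^2(\mu)$ of $F$ one has $\sum_{k=1}^\infty\mathbb{E}\bigl[\bigl(f(\mathbb{X}^{(k)})-f(\mathbb{X})\bigr)^2\bigr]<\infty$. (iv) With the infinite Hoeffding decomposition $F=\sum_{M\in\mathcal{P}_{fin}(\mathbb{N})}F_M=\sum_{p=0}^\infty F^{(p)}$ of $F$ one has $$\sum_{p=1}^\infty p\,\mathbb{E}\bigl[(F^{(p)})^2\bigr]=\sum_{M\in\mathcal{P}_{fin}(\mathbb{N})}|M|\,\mathbb{E}[F_M^2]<\infty.$$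
   Context: Let $(E_n,\mathcal{B}_n,\mu_n)$, $n\in\mathbb{N}$, be probability spaces with product $(E,\mathcal{B},\mu)$. On a probability space $(\Omega,\mathcal{A},\mathbb{P})$ let $\mathbb{X}=(X_n)_{n\in\mathbb{N}}$ and $\mathbb{X}'=(X'_n)_{n\in\mathbb{N}}$ be two independent $E$-valued random sequences, each with distribution $\mu$. For $k\in\mathbb{N}$, $\mathbb{X}^{(k)}$ is obtained from $\mathbb{X}$ by replacing $X_k$ with $X_k'$. Let $\mathcal{F}=\sigma(\mathbb{X})$, $\mathcal{F}_M=\sigma(X_j:j\in M)$, $\mathcal{F}_n=\mathcal{F}_{\{1,\dotsc,n\}}$, $\mathcal{G}_k=\sigma(X_j:j\neq k)$, $L^r_{\mathbb{X}}=L^r(\Omega,\mathcal{F},\mathbb{P})$. A representative of $F\in L^2_{\mathbb{X}}$ is a function $f\in L^2(\mu)$ with $F=f(\mathbb{X})$ a.s. $\kappa$ is counting measure on $\mathbb{N}$ and $\mathbb{P}_{\mathcal F}$ the restriction of $\mathbb{P}$ to $\mathcal{F}$. Hoeffding decomposition: for $F\in L^2_{\mathbb{X}}$ and $M$ in $\mathcal{P}_{fin}(\mathbb{N})$ (finite subsets of $\mathbb{N}$), $F_M:=\sum_{L\subseteq M}(-1)^{|M|-|L|}\mathbb{E}[F\mid\mathcal{F}_L]$ and $F^{(p)}:=\sum_{|M|=p}F_M$; the $F_M$ are pairwise orthogonal and $F=\sum_MF_M=\sum_{p\ge0}F^{(p)}$, all series converging unconditionally in $L^2(\mathbb{P})$.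 Malliavin derivative: for $F\in L^1_{\mathbb{X}}$, $D_kF:=F-\mathbb{E}[F\mid\mathcal{G}_k]$. Let $\mathcal{S}$ be the space of cylindrical random variables, i.e. of $F\in L^2_{\mathbb{X}}$ that are $\mathcal{F}_n$-measurable for some $n\in\mathbb{N}$. On $\mathcal{S}$ define $DF:=(D_kF)_{k\in\mathbb{N}}\in L^2(\kappa\otimes\mathbb{P}_{\mathcal F})$. This operator is closable; its closure is again denoted by $D:\operatorname{dom}(D)\subseteq L^2_{\mathbb{X}}\to L^2(\kappa\otimes\mathbb{P}_{\mathcal F})$. *)

(* Defs.v *)
From HB Require Import structures.
From mathcomp Require Import all_boot all_order all_algebra finmap.
From mathcomp Require Import all_classical all_reals all_analysis.

Set Implicit Arguments.
Unset Strict Implicit.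
Unset Printing Implicit Defensive.

Import Order.TTheory GRing.Theory Num.Theory.
Import numFieldNormedType.Exports.

Local Open Scope classical_set_scope.
Local Open Scope ring_scope.

(* The countable product of the measurable spaces E 0, E 1, ...  An alias of
   the dependent product, so that its sigma-algebra (the one generated by the
   coordinate maps) is found by unification. *)
Definition seqspace (d : nat -> measure_display)
  (E : forall n, measurableType (d n)) : Type := forall n, E n.

Definition seqspace_display (d : nat -> measure_display) : measure_display.
Proof. exact: (d 0%N). Qed.

Section seqspace_measurable.
Context (d : nat -> measure_display) (E : forall n, measurableType (d n)).

Definition cylinders : set (set (seqspace E)) :=
  \bigcup_n preimage_set_system setT (fun x : seqspace E => x n) measurable.

Let seqspace_set0 : <<s cylinders >> set0.
Proof. exact: sigma_algebra0. Qed.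

Let seqspace_setC A : <<s cylinders >> A -> <<s cylinders >> (~` A).
Proof. exact: sigma_algebraC. Qed.

Let seqspace_bigcup (F : (set (seqspace E))^nat) :
  (forall i, <<s cylinders >> (F i)) -> <<s cylinders >> (\bigcup_i F i).
Proof. exact: sigma_algebra_bigcup. Qed.

HB.instance Definition _ := Pointed.copy (seqspace E) (forall n, E n).

HB.instance Definition _ := @isMeasurable.Build (seqspace_display d)
  (seqspace E) <<s cylinders >> seqspace_set0 seqspace_setC seqspace_bigcup.

End seqspace_measurable.

(* mu is the product of the mu_ n: this determines mu, since the finite
   rectangles are stable under intersection and generate the sigma-algebra. *)
Definition is_product_measure (R : realType) (d : nat -> measure_display)
    (E : forall n, measurableType (d n)) (mu_ : forall n, probability (E n) R)
    (mu : probability (seqspace E) R) : Prop :=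
  forall (n : nat) (A : forall i, set (E i)),
    (forall i, measurable (A i)) ->
    mu [set x | forall i, (i < n)%N -> A i (x i)] =
      (\prod_(i < n) mu_ i (A i))%E.

Definition independent_RV (R : realType) dO (Omega : measurableType dO)
    (P : probability Omega R) d1 (T1 : measurableType d1)
    d2 (T2 : measurableType d2)
    (X : {mfun Omega >-> T1}) (Y : {mfun Omega >-> T2}) : Prop :=
  forall A B, measurable A -> measurable B ->
    P (X @^-1` A `&` Y @^-1` B) = (P (X @^-1` A) * P (Y @^-1` B))%E.

(* X^(k): the k-th entry of X is replaced by that of X'. *)
Definition resample (d : nat -> measure_display)
    (E : forall n, measurableType (d n)) (Omega : Type)
    (X X' : Omega -> seqspace E) (k : nat) : Omega -> seqspace E :=
  fun w => dfwith (X w) k (X' w k).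

Section conditional_expectation.
Context (R : realType) dO (Omega : measurableType dO) (P : probability Omega R).
Implicit Types (G : set (set Omega)) (F Z : Omega -> R).

Definition measurable_wrt G F : Prop :=
  measurable_fun setT (F : g_sigma_algebraType G -> R).

(* Z is a version of E[F | <<s G >>]. *)
Definition is_cond_exp G F Z : Prop :=
  [/\ measurable_wrt G Z, P.-integrable setT (EFin \o Z) &
      forall A, <<s G >> A ->
        (\int[P]_(w in A) (Z w)%:E = \int[P]_(w in A) (F w)%:E)%E].

Definition cond_exp G F : Omega -> R := xget (cst 0) (is_cond_exp G F).

End conditional_expectation.

Section sigma_X.
Context (d : nat -> measure_display) (E : forall n, measurableType (d n))
  dO (Omega : measurableType dO) (X : {mfun Omega >-> seqspace E}).

(* The measurable space (Omega, sigma(X)). *)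
Definition Omega_X := g_sigma_algebra_preimageType X.

Definition id_X : Omega -> Omega_X := id.

Lemma measurable_id_X : measurable_fun setT id_X.
Proof.
move=> _ _ [B mB <-]; rewrite !setTI.
by rewrite -[_ @^-1` _]setTI; exact: measurable_funPT.
Qed.

HB.instance Definition _ :=
  @isMeasurableFun.Build _ _ Omega Omega_X id_X measurable_id_X.

End sigma_X.

Section hoeffding_malliavin.
Context (R : realType) (d : nat -> measure_display)
  (E : forall n, measurableType (d n))
  dO (Omega : measurableType dO) (P : probability Omega R)
  (X : {mfun Omega >-> seqspace E}).
Implicit Types (F : Omega -> R) (M : {fset nat}).

Local Notation Omega_X := (Omega_X X).

(* The restriction of P to sigma(X), as the image of P under the identity
   (Omega, A) -> (Omega, sigma(X)). *)
Definition P_X : probability Omega_X R := distribution P (id_X X).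

Definition L2_X : set (Omega -> R) :=
  [set F | (F : Omega_X -> R) \in Lfun P_X 2%:E].

(* A generator of sigma(X_j : j in M). *)
Definition coord_gen (M : set nat) : set (set Omega) :=
  \bigcup_(j in M) preimage_set_system setT (fun w => X w j) measurable.

Definition malliavin_D F (k : nat) : Omega -> R :=
  fun w => F w - cond_exp P (coord_gen (~` [set k])) F w.

(* Indices start at 0, so `I_n = {0, ..., n-1} plays the role of {1, ..., n}. *)
Definition cylindrical : set (Omega -> R) :=
  [set F | L2_X F /\ exists n, measurable_wrt (coord_gen `I_n) F].

Definition kappaP : {measure set (nat * Omega_X) -> \bar R} :=
  (@counting nat R \x P_X)%E.

Definition L2_kappaP : set (nat -> Omega -> R) :=
  [set U | (fun q : nat * Omega_X => U q.1 q.2) \in Lfun kappaP 2%:E].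

(* The closure in L2_X x L2(kappa (x) P_X) of the graph of D on cylindrical. *)
Definition closed_graph_D F (U : nat -> Omega -> R) : Prop :=
  [/\ L2_X F, L2_kappaP U &
      forall e : R, 0 < e -> exists G : Omega -> R,
        [/\ cylindrical G,
            ('N[P_X]_2%:E [(fun w : Omega_X => (F w - G w)%:E)] < e%:E)%E &
            ('N[kappaP]_2%:E [(fun q : nat * Omega_X =>
               (U q.1 q.2 - malliavin_D G q.1 q.2)%:E)] < e%:E)%E]].

Definition dom_D : set (Omega -> R) :=
  [set F | exists U, closed_graph_D F U].

Definition is_representative (mu : probability (seqspace E) R) F
    (f : seqspace E -> R) : Prop :=
  f \in Lfun mu 2%:E /\ {ae P, forall w, F w = f (X w)}.

Definition hoeffding F M : Omega -> R :=
  fun w => \sum_(L <- fpowerset M)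
    (-1) ^+ (#|` M| - #|` L|) * cond_exp P (coord_gen [set` L]) F w.

(* S is the unconditional L2-sum of the hoeffding F M over #|` M| = p, i.e. the
   limit of the net of finite partial sums. *)
Definition is_hoeffding_level F (p : nat) (S : Omega -> R) : Prop :=
  L2_X S /\
  forall e : R, 0 < e -> exists J0 : {fset {fset nat}},
    forall J : {fset {fset nat}}, (J0 `<=` J)%fset ->
      ('N[P]_2%:E [(fun w =>
         (S w - \sum_(M <- J | #|` M| == p) hoeffding F M w)%:E)] < e%:E)%E.

Definition hoeffding_level F (p : nat) : Omega -> R :=
  xget (cst 0) (is_hoeffding_level F p).

End hoeffding_malliavin.

(* Main.v *)
Require Import Defs.
From HB Require Import structures.
From mathcomp Require Import all_boot all_order all_algebra finmap.
From mathcomp Require Import all_classical all_reals all_analysis.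
From mathcomp Require Import measurable_realfun ring lra.

(** The proof takes place in the Hilbert space L2(P), with inner product
    [ip P F G = E[F G]].  Conditional expectations are the orthogonal
    projections onto the subspaces of functions measurable with respect to a
    sub-sigma-algebra ([cond_expP]; the projections exist because L2 is
    complete, [riesz_fischer]).  For a set M of indices let T_M be the
    projection onto the functions of the coordinates X_j, j in M.

    All the probability is in one consequence of the independence of the
    coordinates: T_M T_L = T_(L /\ M).  Hence the vectors T_M F have the Gram
    matrix <T_L F, T_M F> = q(L /\ M) with q(M) = |T_M F|^2 ([gram_cond_exp]),
    and q(M /\ {0, ..., n-1}) tends to q(M) ([ip_sqr_cond_exp_cvg]).  The rest
    of the Hoeffding decomposition is combinatorics of this Gram matrix: the
    F_M are alternating sums of the T_L F, so they are orthogonal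
    ([hoeffding_orthogonal]), and Moebius inversion gives
    q(M) = sum of |F_L|^2 over the subsets L of M
    ([ip_sqr_cond_exp_hoeffding]).

    - (ii) and (iv).  With I the set of all indices,
      |D_k F|^2 = q(I) - q(I \ {k}) is the limit of
      q({0, ..., n-1}) - q({0, ..., n-1} \ {k}), which is the sum of |F_M|^2
      over the finite sets M that contain k ([esum_hoeffding_mem]).  Summing
      over k counts every F_M exactly |M| times ([nneseries_malliavin]).
      Grouping the M by cardinality gives the series of the levels F^(p)
      ([ip_hoeffding_level], [level_energy]).
    - (ii) and (iii).  Given the coordinates other than k, f(X^(k)) and f(X)
      are independent with the same law, and so
      E[(f(X^(k)) - f(X))^2] = 2 E[(D_k F)^2] ([ip_sqr_resample]), for every
      representative f.  A representative exists because F is measurable with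
      respect to X ([doob_dynkin]).
    - (i) and (ii).  D_k has norm at most 1, so an L2 limit of the fields D G,
      with G cylindrical and tending to F, can only be D F
      ([dom_D_energy]).  Conversely, G_n = T_{0, ..., n-1} F
      is cylindrical and |D_k F - D_k G_n|^2 = |D_k F|^2 - |D_k G_n|^2
      tends to 0 for every k and is dominated by the summable |D_k F|^2
      ([nneseries_malliavin_approx], [energy_dom_D]). *)

Set Implicit Arguments.
Unset Strict Implicit.
Unset Printing Implicit Defensive.

Import Order.TTheory GRing.Theory Num.Theory.
Import numFieldNormedType.Exports.

Local Open Scope classical_set_scope.
Local Open Scope ring_scope.

(** * Square integrable functions and their inner product *)

Section square_integrable.
Context (R : realType) d (T : measurableType d) (mu : {measure set T -> \bar R}).
Implicit Types F : T -> R.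

Lemma Lnorm2E F :
  ('N[mu]_2%:E [(fun w => (F w)%:E)] = (\int[mu]_w (F w ^+ 2)%:E) `^ 2^-1)%E.
Proof.
rewrite unlock; congr (_ `^ _)%E; apply: eq_integral => w _ /=.
by rewrite powR_mulrn// -normrX ger0_norm// sqr_ge0.
Qed.

(** Membership in [Lfun] is finiteness of a real power of an integral of a real
    power; in terms of the integral of the square it can be proved directly. *)
Lemma Lfun2P F : F \in Lfun mu 2%:E <->
  measurable_fun setT F /\ (\int[mu]_w (F w ^+ 2)%:E < +oo)%E.
Proof.
split=> [LF|[mF Foo]].
  move: (LF); rewrite inE => /andP[/[1!inE] mF _]; split => //.
  have /integrableP[_] := Lfun2_integrable_sqr LF.
  by under eq_integral do rewrite gee0_abs ?lee_fin ?sqr_ge0//.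
rewrite inE; apply/andP; rewrite !inE/=; split => //.
by rewrite /finite_norm Lnorm2E poweR_lty.
Qed.

Lemma Lnorm2_lt F e : 0 < e ->
  ('N[mu]_2%:E [(fun w => (F w)%:E)] < e%:E)%E =
  (\int[mu]_w (F w ^+ 2)%:E < (e ^+ 2)%:E)%E.
Proof.
move=> e0; rewrite Lnorm2E.
have : (0 <= \int[mu]_w (F w ^+ 2)%:E)%E.
  by apply: integral_ge0 => w _; rewrite lee_fin sqr_ge0.
case: (\int[mu]_w _)%E => [r r0| _|//]; last first.
  by rewrite poweRyr ?invr_eq0 ?pnatr_eq0.
rewrite poweR_EFin powR12_sqrt; last by rewrite -lee_fin.
by rewrite !lte_fin -[X in _ < X]gtr0_norm// -sqrtr_sqr ltr_sqrt// exprn_gt0.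
Qed.

End square_integrable.

Section inner_product.
Context (R : realType) d (T : measurableType d) (P : probability T R).
Implicit Types (F G H : T -> R) (a : R) (A : set T).

Definition L2 F : Prop := F \in Lfun P 2%:E.

Definition ip F G : R := fine (\int[P]_w (F w * G w)%:E).

Lemma L2_measurable F : L2 F -> measurable_fun setT F.
Proof. by move=> /Lfun2P[]. Qed.

Lemma L2_integrableM F G : L2 F -> L2 G ->
  P.-integrable setT (fun w => (F w * G w)%:E).
Proof.
by move=> LF LG; exact: (Lfun1_integrable _ _).1 (Lfun2_mul_Lfun1 LF LG).
Qed.

Lemma L2_integrable F : L2 F -> P.-integrable setT (EFin \o F).
Proof.
by move=> /(Lfun_subset12 (fin_num_measure P _ measurableT))/Lfun1_integrable.
Qed.

Lemma L2_sqr_lty F : measurable_fun setT F ->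
  (\int[P]_w (F w ^+ 2)%:E < +oo)%E -> L2 F.
Proof. by move=> mF Foo; exact/Lfun2P. Qed.

Lemma L2_lty F : L2 F -> (\int[P]_w (F w ^+ 2)%:E < +oo)%E.
Proof. by move=> /Lfun2P[]. Qed.

Lemma L2D F G : L2 F -> L2 G -> L2 (fun w => F w + G w).
Proof. exact: (Lfun_addr_closed _ (lee1n 2)).2. Qed.

Lemma L2Z a F : L2 F -> L2 (fun w => a * F w).
Proof.
have -> : (fun w => a * F w) = a \o* F by apply/funext => w /=; rewrite mulrC.
by apply: Lfun_scale; rewrite ler1n.
Qed.

Lemma L2B F G : L2 F -> L2 G -> L2 (fun w => F w - G w).
Proof.
move=> LF LG.
have -> : (fun w => F w - G w) = (fun w => F w + -1 * G w).
  by apply/funext => w; rewrite mulN1r.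
exact/L2D/L2Z.
Qed.

Lemma L2_cst a : L2 (cst a).
Proof. exact: Lfun_cst. Qed.

Lemma L2_sum I (r : seq I) (p : pred I) (f : I -> T -> R) :
  (forall i, p i -> L2 (f i)) -> L2 (fun w => \sum_(i <- r | p i) f i w).
Proof.
move=> Lf; elim: r => [|i r IH].
  have -> : (fun w => \sum_(i <- [::] | p i) f i w) = cst 0.
    by apply/funext => w; rewrite big_nil.
  exact: L2_cst.
have -> : (fun w => \sum_(j <- i :: r | p j) f j w) = if p i then
    (fun w => f i w + \sum_(j <- r | p j) f j w)
  else (fun w => \sum_(j <- r | p j) f j w).
  by case: ifPn => pi; apply/funext => w; rewrite big_cons ?pi ?(negbTE pi).
by case: ifPn => // pi; apply/L2D/IH/Lf.
Qed.

Lemma L2_mul_indic F A : measurable A -> L2 F -> L2 (fun w => F w * \1_A w).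
Proof.
move=> mA LF; apply: L2_sqr_lty.
  by apply: measurable_funM; [exact: L2_measurable|exact: measurable_indic].
apply: le_lt_trans (L2_lty LF); apply: ge0_le_integral => //=.
- by move=> w _; rewrite lee_fin sqr_ge0.
- apply/measurable_EFinP/measurable_funX/measurable_funM; first exact: L2_measurable.
  exact: measurable_indic.
- exact/measurable_EFinP/measurable_funX/L2_measurable.
- move=> w _; rewrite lee_fin indicE.
  by case: (w \in A); rewrite ?mulr1// mulr0 expr0n/= sqr_ge0.
Qed.

Lemma L2_indic A : measurable A -> L2 (\1_A : T -> R).
Proof.
move=> mA; have := L2_mul_indic mA (L2_cst 1).
by congr L2; apply/funext => w; rewrite /= mul1r.
Qed.

Lemma ipC F G : ip F G = ip G F.
Proof. by congr fine; apply: eq_integral => w _; rewrite mulrC. Qed.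

Lemma eq_ip F F' G G' : F =1 F' -> G =1 G' -> ip F G = ip F' G'.
Proof. by move=> /funext -> /funext ->. Qed.

Lemma eq_ip_sqr F F' : F =1 F' -> ip F F = ip F' F'.
Proof. by move=> /funext ->. Qed.

Lemma eq_ip_mul F G F' G' : (forall w, F w * G w = F' w * G' w) ->
  ip F G = ip F' G'.
Proof. by move=> h; congr fine; apply: eq_integral => w _; rewrite h. Qed.

Lemma ip_sqrBC F G :
  ip (fun w => F w - G w) (fun w => F w - G w) =
  ip (fun w => G w - F w) (fun w => G w - F w).
Proof. by apply: eq_ip_mul => w; ring. Qed.

Lemma ipE F G : L2 F -> L2 G -> (\int[P]_w (F w * G w)%:E)%E = (ip F G)%:E.
Proof. by move=> LF LG; rewrite fineK//; exact/integrable_fin_num/L2_integrableM. Qed.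

Lemma ip_sqrE F : L2 F -> (\int[P]_w (F w ^+ 2)%:E)%E = (ip F F)%:E.
Proof. by move=> LF; rewrite -ipE. Qed.

Lemma expectation_sqrE F : L2 F -> 'E_P[(fun w => F w ^+ 2)%R]%E = (ip F F)%:E.
Proof. by move=> LF; rewrite unlock ip_sqrE. Qed.

Lemma ipDl F G H : L2 F -> L2 G -> L2 H ->
  ip (fun w => F w + G w) H = ip F H + ip G H.
Proof.
move=> LF LG LH; apply: EFin_inj; rewrite -ipE//; last exact: L2D.
under eq_integral do rewrite mulrDl EFinD.
by rewrite integralD//; [rewrite !ipE|exact: L2_integrableM|exact: L2_integrableM].
Qed.

Lemma ipZl a F H : L2 F -> L2 H -> ip (fun w => a * F w) H = a * ip F H.
Proof.
move=> LF LH; apply: EFin_inj; rewrite -ipE//; last exact: L2Z.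
under eq_integral do rewrite -mulrA EFinM.
by rewrite integralZl//; [rewrite ipE|exact: L2_integrableM].
Qed.

Lemma ipBl F G H : L2 F -> L2 G -> L2 H ->
  ip (fun w => F w - G w) H = ip F H - ip G H.
Proof.
move=> LF LG LH; rewrite (eq_ip (F' := fun w => F w + -1 * G w) (G' := H))//.
  by rewrite ipDl ?ipZl ?mulN1r//; exact: L2Z.
by move=> w; rewrite mulN1r.
Qed.

Lemma ipDr F G H : L2 F -> L2 G -> L2 H ->
  ip H (fun w => F w + G w) = ip H F + ip H G.
Proof. by move=> *; rewrite ipC ipDl// !(ipC H). Qed.

Lemma ipZr a F H : L2 F -> L2 H -> ip H (fun w => a * F w) = a * ip H F.
Proof. by move=> *; rewrite ipC ipZl// !(ipC H). Qed.

Lemma ipBr F G H : L2 F -> L2 G -> L2 H ->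
  ip H (fun w => F w - G w) = ip H F - ip H G.
Proof. by move=> *; rewrite ipC ipBl// !(ipC H). Qed.

Lemma ip0l G : ip (cst 0) G = 0.
Proof. by rewrite /ip; under eq_integral do rewrite mul0r; rewrite integral0. Qed.

Lemma ip_suml I (r : seq I) (p : pred I) (f : I -> T -> R) H :
  (forall i, p i -> L2 (f i)) -> L2 H ->
  ip (fun w => \sum_(i <- r | p i) f i w) H = \sum_(i <- r | p i) ip (f i) H.
Proof.
move=> Lf LH; elim: r => [|i r IH].
  by rewrite big_nil -[RHS](ip0l H); apply: eq_ip => // w; rewrite big_nil.
rewrite big_cons (eq_ip (F' := fun w => if p i then f i w +
    \sum_(j <- r | p j) f j w else \sum_(j <- r | p j) f j w) (G' := H))//; last first.
  by move=> w; rewrite big_cons.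
case: ifPn => pi; last exact: IH.
by rewrite ipDl ?IH//; [exact: Lf|exact: L2_sum].
Qed.

Lemma ip_sumr I (r : seq I) (p : pred I) (f : I -> T -> R) H :
  (forall i, p i -> L2 (f i)) -> L2 H ->
  ip H (fun w => \sum_(i <- r | p i) f i w) = \sum_(i <- r | p i) ip H (f i).
Proof. by move=> *; rewrite ipC ip_suml//; apply: eq_bigr => i _; rewrite ipC. Qed.

Lemma ip_ge0 F : 0 <= ip F F.
Proof. by apply/fine_ge0/integral_ge0 => w _; rewrite lee_fin -expr2 sqr_ge0. Qed.

Lemma ip_sqrD F G : L2 F -> L2 G ->
  ip (fun w => F w + G w) (fun w => F w + G w) = ip F F + 2 * ip F G + ip G G.
Proof.
by move=> LF LG; rewrite ipDl ?ipDr//; [rewrite (ipC G F); ring|exact: L2D].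
Qed.

Lemma ip_sqrB F G : L2 F -> L2 G ->
  ip (fun w => F w - G w) (fun w => F w - G w) = ip F F - 2 * ip F G + ip G G.
Proof.
by move=> LF LG; rewrite ipBl ?ipBr//; [rewrite (ipC G F); ring|exact: L2B].
Qed.

(** A substitute for the triangle inequality that is linear in the squared
    norms, so that no square root is needed in limit arguments. *)
Lemma ip_sqrD_le F G : L2 F -> L2 G ->
  ip (fun w => F w + G w) (fun w => F w + G w) <= 2 * ip F F + 2 * ip G G.
Proof.
move=> LF LG; have := ip_ge0 (fun w => F w - G w).
by rewrite ip_sqrB// ip_sqrD//; lra.
Qed.

(** When [G] is not null, the squared norm of
    [ip G G * F - ip F G * G] is nonnegative.  When it is null, the squared norm
    of [F + t * G] is affine in [t], so its slope vanishes. *)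
Lemma cauchy_schwarz F G : L2 F -> L2 G -> ip F G ^+ 2 <= ip F F * ip G G.
Proof.
move=> LF LG; have := ip_ge0 G; rewrite le_eqVlt => /predU1P[G0|G0].
  rewrite -G0 mulr0.
  have h t : 0 <= ip F F + 2 * t * ip F G.
    have := ip_ge0 (fun w => F w + t * G w).
    have LtG := L2Z t LG.
    by rewrite ip_sqrD// ipZr// ipZl// ipZr// -G0 !mulr0 addr0 mulrA.
  have [->|/eqP b0] := eqVneq (ip F G) 0; first by rewrite expr0n.
  have := h (- (ip F F + 1) / (2 * ip F G)).
  by rewrite [X in 0 <= X](_ : _ = -1) ?ler0N1//; field; exact/eqP.
have := ip_ge0 (fun w => ip G G * F w - ip F G * G w).
have LaF := L2Z (ip G G) LF; have LbG := L2Z (ip F G) LG.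
rewrite ip_sqrB// !ipZl// !ipZr//.
rewrite [X in 0 <= X](_ : _ = ip G G * (ip F F * ip G G - ip F G ^+ 2)); last by ring.
by rewrite pmulr_rge0// subr_ge0.
Qed.

Lemma eq_ip_ae F F' G G' : measurable_fun setT F -> measurable_fun setT F' ->
  measurable_fun setT G -> measurable_fun setT G' ->
  {ae P, forall w, F w = F' w} -> {ae P, forall w, G w = G' w} ->
  ip F G = ip F' G'.
Proof.
move=> mF mF' mG mG' FF' GG'; congr fine; apply: ae_eq_integral => //.
- exact/measurable_EFinP/measurable_funM.
- exact/measurable_EFinP/measurable_funM.
- by apply: filterS2 FF' GG' => w -> ->.
Qed.

Lemma L2_ae F G : measurable_fun setT G -> {ae P, forall w, F w = G w} ->
  L2 F -> L2 G.
Proof.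
move=> mG FG LF; apply: L2_sqr_lty => //.
rewrite (ae_eq_integral (fun w => (F w ^+ 2)%:E)) ?L2_lty//.
- exact/measurable_EFinP/measurable_funX.
- exact/measurable_EFinP/measurable_funX/L2_measurable.
- by apply: filterS FG => w ->.
Qed.

Lemma ip0_ae F : L2 F -> ip F F = 0 -> {ae P, forall w, F w = 0}.
Proof.
move=> LF F0.
have mF2 : measurable_fun setT (fun w => (F w ^+ 2)%:E).
  exact/measurable_EFinP/measurable_funX/L2_measurable.
have /(ae_eq_integral_abs P measurableT mF2) : (\int[P]_w `|(F w ^+ 2)%:E| = 0)%E.
  under eq_integral do rewrite gee0_abs ?lee_fin ?sqr_ge0//.
  by rewrite ip_sqrE// F0.
by apply: filterS => w /(_ I) [] /eqP; rewrite sqrf_eq0 => /eqP.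
Qed.

Lemma ip1_indic A : measurable A -> ip (cst 1) \1_A = fine (P A).
Proof.
move=> mA; rewrite /ip; under eq_integral do rewrite mul1r.
by rewrite integral_indic ?setIT.
Qed.

Lemma ip_indic F A : measurable A ->
  ip F \1_A = fine (\int[P]_(w in A) (F w)%:E).
Proof.
move=> mA; rewrite [in RHS]integral_mkcond/=; congr fine; apply: eq_integral => w _.
by rewrite patchE indicE; case: (w \in A); rewrite ?mulr1// mulr0.
Qed.

Lemma integral_ip_indic F A : L2 F -> measurable A ->
  (\int[P]_(w in A) (F w)%:E = (ip F \1_A)%:E)%E.
Proof.
move=> LF mA; rewrite ip_indic// fineK//; apply: integrable_fin_num => //.
by apply: (integrableS measurableT) => //; exact: L2_integrable.
Qed.

Lemma Lnorm_lt F e : 0 < e -> L2 F ->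
  ('N[P]_2%:E [(fun w => (F w)%:E)] < e%:E)%E = (ip F F < e ^+ 2).
Proof. by move=> e0 LF; rewrite Lnorm2_lt// ip_sqrE// lte_fin. Qed.

End inner_product.

(** * Completeness of L2 *)

Section completeness.
Context (R : realType) d (T : measurableType d) (P : probability T R).
Implicit Types (F G H : T -> R) (Y : (T -> R)^nat).

(** The limit of an almost surely convergent sequence.  The upper limit is
    defined everywhere, so it is measurable for every sigma-algebra that makes
    the terms measurable, even one that does not contain the null sets. *)
Definition pointwise_limsup Y : T -> R :=
  fun w => fine (limn_esup (fun n => (Y n w)%:E)).

Lemma measurable_pointwise_limsup (G : set (set T)) Y :
  (forall n, measurable_wrt G (Y n)) -> measurable_wrt G (pointwise_limsup Y).
Proof.
move=> mY; apply: (measurableT_comp (fine_measurable measurableT)).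
apply: (@measurable_fun_limn_esup _ (g_sigma_algebraType G)) => n.
by apply/measurable_EFinP; exact: mY.
Qed.

Lemma ip_norm F : L2 P F -> ip P (fun w => `|F w|) (fun w => `|F w|) = ip P F F.
Proof.
move=> LF; congr fine; apply: eq_integral => w _.
by rewrite -!expr2 real_normK// num_real.
Qed.

Lemma L2_norm F : L2 P F -> L2 P (fun w => `|F w|).
Proof.
move=> LF; apply: L2_sqr_lty.
  by apply: measurableT_comp => //; exact: L2_measurable LF.
by under eq_integral do rewrite real_normK ?num_real//; exact: L2_lty.
Qed.

Lemma ip11 : ip P (cst 1) (cst 1) = 1.
Proof.
rewrite /ip (eq_integral (cst 1%E)); last by move=> w _; rewrite mulr1.
by rewrite integral_cst//= probability_setT mul1e.
Qed.

(** Cauchy-Schwarz against the constant 1, whose norm is 1 because P has mass 1. *)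
Lemma expectation_norm_le F e : L2 P F -> 0 <= e -> ip P F F <= e ^+ 2 ->
  (\int[P]_w `|F w|%:E <= e%:E)%E.
Proof.
move=> LF e0 Fe; have LnF := L2_norm LF.
rewrite (_ : (\int[P]_w _)%E = (ip P (fun w => `|F w|) (cst 1))%:E); last first.
  rewrite -ipE//; last exact: L2_cst.
  by apply: eq_integral => w _; rewrite mulr1.
rewrite lee_fin -(ler_pXn2r (_ : (0 < 2)%N))// ?nnegrE//; last first.
  by apply/fine_ge0/integral_ge0 => w _; rewrite lee_fin mulr1.
by rewrite (le_trans (cauchy_schwarz LnF (L2_cst P 1)))// ip11 mulr1 ip_norm.
Qed.

Lemma cvg_telescope_summable (u : R^nat) :
  (\sum_(0 <= k <oo) `|u k.+1 - u k|%:E < +oo)%E -> cvgn u.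
Proof.
move=> uoo.
suff : cvgn (series (telescope u)).
  move=> h; rewrite (_ : u = (fun n => u 0%N + series (telescope u) n)); last first.
    by apply/funext => n; rewrite -eq_sum_telescope.
  by apply/cvg_ex; eexists; apply: cvgD; [exact: cvg_cst|exact: h].
apply: normed_cvg; apply: nondecreasing_is_cvgn.
  by apply: nondecreasing_series => *; exact: normr_ge0.
have sfin : (\sum_(0 <= k <oo) `|u k.+1 - u k|%:E)%E \is a fin_num.
  by rewrite ge0_fin_numE// nneseries_ge0// => n _ _; rewrite lee_fin.
exists (fine (\sum_(0 <= k <oo) `|u k.+1 - u k|%:E)%E) => _ [n _ <-] /=.
rewrite -lee_fin fineK// /series/= -sumEFin.
by apply: nneseries_lim_ge => k _ _; rewrite lee_fin.
Qed.

Lemma limn_einf_le (u : (\bar R)^nat) (e : \bar R) N :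
  (forall k, (N <= k)%N -> u k <= e)%E -> (limn_einf u <= e)%E.
Proof.
move=> ue; rewrite limn_einf_lim; apply: lime_le; first exact: is_cvg_einfs.
near=> k; apply: (@le_trans _ _ (u k)).
  by apply: ereal_inf_lbound; exists k => //=.
by apply: ue; near: k; exact: nbhs_infty_ge.
Unshelve. all: by end_near. Qed.

(** Fatou's lemma lets a bound on the distances from [F] to the terms of a
    sequence pass to an almost sure limit. *)
Lemma fatou_L2 F Y (G : T -> R) e N : L2 P F -> (forall n, L2 P (Y n)) ->
  measurable_fun setT G ->
  {ae P, forall w, Y n w @[n --> \oo] --> G w} ->
  (forall n, (N <= n)%N -> ip P (fun w => F w - Y n w) (fun w => F w - Y n w) <= e) ->
  (\int[P]_w ((F w - G w) ^+ 2)%:E <= e%:E)%E.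
Proof.
move=> LF LY mG YG FY.
have LFY n : L2 P (fun w => F w - Y n w) by exact: L2B.
have mF := L2_measurable LF.
apply: (@le_trans _ _ (\int[P]_w limn_einf (fun n => ((F w - Y n w) ^+ 2)%:E))%E).
  rewrite le_eqVlt; apply/orP; left; apply/eqP; apply: ae_eq_integral => //.
  - exact/measurable_EFinP/measurable_funX/measurable_funB.
  - rewrite (_ : (fun w => _) = (fun w =>
        - limn_esup (fun n => - ((F w - Y n w) ^+ 2)%:E))%E); last first.
      apply/funext => w; rewrite -limn_einfN; congr limn_einf.
      by apply/funext => n /=; rewrite opprK.
    apply: measurableT_comp => //; apply: measurable_fun_limn_esup => n.
    apply: measurableT_comp => //.
    exact/measurable_EFinP/measurable_funX/L2_measurable.
  - apply: filterS YG => w YG _.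
    suff /cvg_limn_einf_sup[-> _] :
      ((F w - Y n w) ^+ 2)%:E @[n --> \oo] --> ((F w - G w) ^+ 2)%:E by [].
    apply: cvg_EFin; first exact: nearW.
    by apply: cvgM; apply: cvgB => //; exact: cvg_cst.
apply: le_trans (fatou _ _ _ _) _ => //.
- by move=> n; exact/measurable_EFinP/measurable_funX/L2_measurable.
- by move=> n w _; rewrite lee_fin sqr_ge0.
by apply: (@limn_einf_le _ _ N) => n Nn; rewrite ip_sqrE// lee_fin FY.
Qed.

(** A subsequence with increments below 2^-(k+1) in L2 has summable increments
    in L1, hence it converges almost surely, and Fatou's lemma turns this into
    convergence of the whole sequence in L2.  The second conclusion makes the
    subspace of functions measurable for a given sigma-algebra complete as well. *)
Lemma riesz_fischer Y : (forall n, L2 P (Y n)) ->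
  (forall e, 0 < e -> exists N, forall m n, (N <= m)%N -> (N <= n)%N ->
    ip P (fun w => Y m w - Y n w) (fun w => Y m w - Y n w) < e) ->
  exists S : T -> R,
    [/\ L2 P S,
      forall G : set (set T), (forall n, measurable_wrt G (Y n)) ->
        measurable_wrt G S &
      forall e, 0 < e -> exists N, forall n, (N <= n)%N ->
        ip P (fun w => Y n w - S w) (fun w => Y n w - S w) < e].
Proof.
move=> LY cauchyY.
have LYY m n : L2 P (fun w => Y m w - Y n w) by exact: L2B.
have e_gt0 k : 0 < (1 / (2 ^ k.+1)%:R) ^+ 2 :> R.
  by rewrite exprn_gt0// divr_gt0// ltr0n expn_gt0.
have [f fP] := choice (fun k => cauchyY _ (e_gt0 k)).
(* a nondecreasing sequence of ranks that dominates f and the identity *)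
pose g k := (\sum_(j < k.+1) (f j).+1)%N.
have f_le_g k n : (k <= n)%N -> (f k <= g n)%N.
  move=> kn; rewrite /g (bigD1 (Ordinal (kn : (k < n.+1)%N)))//=.
  exact/ltnW/leq_addr.
have le_g k : (k <= g k)%N.
  rewrite (@leq_trans (\sum_(j < k.+1) 1)%N)//; last by apply: leq_sum.
  by rewrite sum1_card card_ord.
pose S := pointwise_limsup (fun k => Y (g k)).
have mS : measurable_fun setT S.
  apply: (measurableT_comp (fine_measurable measurableT)).
  by apply: measurable_fun_limn_esup => n; exact/measurable_EFinP/L2_measurable/LY.
have YS : {ae P, forall w, Y (g k) w @[k --> \oo] --> S w}.
  have mD k : measurable_fun setT (fun w => `|Y (g k.+1) w - Y (g k) w|%:E).
    exact/measurable_EFinP/L2_measurable/L2_norm.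
  have soo : (\int[P]_w (\sum_(0 <= k <oo) `|Y (g k.+1) w - Y (g k) w|%:E) < +oo)%E.
    rewrite integral_nneseries//.
    apply: (@le_lt_trans _ _ (\sum_(0 <= k <oo) (0 + (1 / (2 ^ k.+1)%:R)%:E))%E).
      apply: lee_nneseries => k _; first by rewrite integral_ge0.
      rewrite add0e; apply: expectation_norm_le => //.
      by apply/ltW/fP; exact: f_le_g.
    apply: le_lt_trans (epsilon_trick xpredT _ _) _ => //.
    by rewrite eseries0// add0e ltry.
  have : P.-integrable setT (fun w => (\sum_(0 <= k <oo) `|Y (g k.+1) w - Y (g k) w|%:E)%E).
    apply/integrableP; split.
      by apply: ge0_emeasurable_sum => //.
    by under eq_integral do rewrite gee0_abs ?nneseries_ge0//.
  move=> /(integrable_ae measurableT); apply: filterS => w /(_ I) sw.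
  have /cvg_telescope_summable cY : (\sum_(0 <= k <oo) `|Y (g k.+1) w - Y (g k) w|%:E < +oo)%E.
    by rewrite ltey_eq sw.
  have /cvg_limn_einf_sup[_ Sw] : (Y (g k) w)%:E @[k --> \oo] --> (limn (fun k => Y (g k) w))%:E.
    by apply: cvg_EFin => //; exact: nearW.
  by rewrite /S /pointwise_limsup Sw.
have lim e N : (forall m n, (N <= m)%N -> (N <= n)%N ->
    ip P (fun w => Y m w - Y n w) (fun w => Y m w - Y n w) < e) -> 
  forall n, (N <= n)%N -> (\int[P]_w ((Y n w - S w) ^+ 2)%:E <= e%:E)%E.
  move=> HN n Nn; apply: (@fatou_L2 _ (fun k => Y (g k)) _ _ N) => // k Nk.
  by apply/ltW/HN => //; exact: leq_trans (le_g k).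
have LS : L2 P S.
  have [N /lim/(_ N (leqnn N)) NS] := cauchyY 1 ltr01.
  rewrite (_ : S = (fun w => Y N w - (Y N w - S w))); last first.
    by apply/funext => w; rewrite opprB addrC subrK.
  apply: L2B => //; apply: L2_sqr_lty; last exact: le_lt_trans NS (ltry _).
  exact/measurable_funB/mS/L2_measurable.
exists S; split => //.
- by move=> G mY; exact: measurable_pointwise_limsup.
- move=> e e0; have e20 : 0 < e / 2 by rewrite divr_gt0.
  have [N /lim NS] := cauchyY _ e20.
  exists N => n /NS; rewrite ip_sqrE ?lee_fin; last exact: L2B.
  by move=> /le_lt_trans; apply; rewrite ltr_pdivrMr// ltr_pMr// ltr1n.
Qed.
End completeness.

(** * Conditional expectation as orthogonal projection *)

Section measurable_wrt.
Context (R : realType) d (T : measurableType d).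
Implicit Types (F : T -> R) (G : set (set T)).

Lemma measurable_wrtD G F F' : measurable_wrt G F -> measurable_wrt G F' ->
  measurable_wrt G (fun w => F w + F' w).
Proof. by move=> mF mF'; exact: (@measurable_funD _ (g_sigma_algebraType G)). Qed.

Lemma measurable_wrtB G F F' : measurable_wrt G F -> measurable_wrt G F' ->
  measurable_wrt G (fun w => F w - F' w).
Proof. by move=> mF mF'; exact: (@measurable_funB _ (g_sigma_algebraType G)). Qed.

Lemma measurable_wrtM G F F' : measurable_wrt G F -> measurable_wrt G F' ->
  measurable_wrt G (fun w => F w * F' w).
Proof. by move=> mF mF'; exact: (@measurable_funM _ (g_sigma_algebraType G)). Qed.

Lemma measurable_wrt_cst G (a : R) : measurable_wrt G (cst a : T -> R).
Proof. exact: (@measurable_cst _ _ (g_sigma_algebraType G)). Qed.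

Lemma measurable_wrtZ G (a : R) F : measurable_wrt G F ->
  measurable_wrt G (fun w => a * F w).
Proof. by move=> mF; apply: measurable_wrtM => //; exact: measurable_wrt_cst. Qed.

Lemma measurable_wrt_indic G A : <<s G >> A -> measurable_wrt G (\1_A : T -> R).
Proof. by move=> GA; apply: (@measurable_indic _ (g_sigma_algebraType G)). Qed.

Lemma measurable_wrtS G G' F : <<s G >> `<=` <<s G' >> ->
  measurable_wrt G F -> measurable_wrt G' F.
Proof. by move=> GG' mF _ B mB; apply: GG'; exact: (mF measurableT B mB). Qed.

Lemma g_sigma_measurable G : G `<=` measurable -> <<s G >> `<=` measurable.
Proof.
by move=> GT; apply: smallest_sub => //; exact: sigma_algebra_measurable.
Qed.

Lemma measurable_wrt_measurable G F : G `<=` measurable ->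
  measurable_wrt G F -> measurable_fun setT F.
Proof.
by move=> GT mF _ B mB; apply: (g_sigma_measurable GT); exact: (mF measurableT B mB).
Qed.

End measurable_wrt.

Section projection.
Context (R : realType) d (T : measurableType d) (P : probability T R).
Context (G : set (set T)) (GT : G `<=` measurable).
Implicit Types (F Z Y : T -> R) (A : set T).

Local Notation ip := (ip P).
Local Notation L2 := (L2 P).

(** The parallelogram identity makes a minimizing sequence [Y n] of the distance
    to the subspace a Cauchy sequence.  Instead of the minimality of the limit,
    the proof passes to the limit in the almost orthogonality of [F - Y n] to
    the subspace. *)
Lemma L2_projection F : L2 F -> exists Z, [/\ L2 Z, measurable_wrt G Z &
  forall Y, L2 Y -> measurable_wrt G Y -> ip (fun w => F w - Z w) Y = 0].
Proof.
move=> LF.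
pose dist Y := ip (fun w => F w - Y w) (fun w => F w - Y w).
pose D := [set dist Y | Y in [set Y | L2 Y /\ measurable_wrt G Y]].
have D0 : D (dist (cst 0)).
  by exists (cst 0) => //; split; [exact: L2_cst|exact: measurable_wrt_cst].
have infD : has_inf D.
  by split; [exists (dist (cst 0))|exists 0 => _ [Y _ <-]; exact: ip_ge0].
have inf_le Y : L2 Y -> measurable_wrt G Y -> inf D <= dist Y.
  by move=> LY mY; apply: ge_inf; [exact: infD.2|exists Y].
have /choice[Y YP] n : exists Y, [/\ L2 Y, measurable_wrt G Y &
    dist Y < inf D + n.+1%:R^-1].
  have n0 : 0 < n.+1%:R^-1 :> R by rewrite invr_gt0.
  by have [_ [Y [LY mY] <-] Yn] := inf_adherent n0 infD; exists Y.
have LY n : L2 (Y n) by have [] := YP n.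
have mY n : measurable_wrt G (Y n) by have [] := YP n.
(* compare [Y n] with [Y n + t * V] for the best t *)
have near_orth n V : L2 V -> measurable_wrt G V ->
    ip (fun w => F w - Y n w) V ^+ 2 <= n.+1%:R^-1 * ip V V.
  move=> LV mV; have LFY : L2 (fun w => F w - Y n w) by exact: L2B.
  have := ip_ge0 P V; rewrite le_eqVlt => /predU1P[V0|V0].
    by rewrite (le_trans (cauchy_schwarz LFY LV))// -V0 !mulr0.
  set b := ip _ V; pose t := b / ip V V.
  have LtV : L2 (fun w => t * V w) by exact: L2Z.
  have := inf_le _ (L2D (LY n) LtV) (measurable_wrtD (mY n) (measurable_wrtZ t mV)).
  have [_ _] := YP n; rewrite /dist.
  rewrite (eq_ip_sqr P (F := fun w => F w - (Y n w + t * V w))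
    (F' := fun w => (F w - Y n w) - t * V w)); last first.
    by move=> w; rewrite opprD addrA.
  rewrite (ip_sqrB LFY LtV) ipZl// !ipZr// -/b => h1 h2.
  move: h1 h2; move: (n.+1%:R^-1) => q; clear LtV; clearbody b; rewrite {}/t => h1 h2.
  have : 0 <= q - 2 * (b / ip V V * b) + b / ip V V * (b / ip V V * ip V V).
    by move: h1 h2; move: (ip _ _) (b / _) => x y; lra.
  rewrite [X in 0 <= X](_ : _ = q - b ^+ 2 / ip V V).
    by rewrite subr_ge0 ler_pdivrMr.
  by field; rewrite gt_eqF.
have [Z [LZ mZ YZ]] : exists S : T -> R,
    [/\ L2 S,
      forall G : set (set T), (forall n, measurable_wrt G (Y n)) ->
        measurable_wrt G S &
      forall e, 0 < e -> exists N, forall n, (N <= n)%N ->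
        ip (fun w => Y n w - S w) (fun w => Y n w - S w) < e].
  apply: riesz_fischer => // e e0.
  exists (Num.truncn (4 / e)).+1 => m n Nm Nn.
  have small k : ((Num.truncn (4 / e)).+1 <= k)%N -> k.+1%:R^-1 < e / 4.
    move=> Nk; rewrite invf_plt ?posrE//; last by rewrite divr_gt0.
    rewrite invf_div (lt_le_trans (truncnS_gt _))// ler_nat.
    exact: leqW.
  have hm := small m Nm; have hn := small n Nn.
  have [_ _ Dm] := YP m; have [_ _ Dn] := YP n.
  have Lm : L2 (fun w => F w - Y m w) by exact: L2B.
  have Ln : L2 (fun w => F w - Y n w) by exact: L2B.
  have Lh : L2 (fun w => 2^-1 * (Y m w + Y n w)) by exact/L2Z/L2D.
  have mh : measurable_wrt G (fun w => 2^-1 * (Y m w + Y n w)).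
    by apply: measurable_wrtZ; apply: measurable_wrtD.
  have := inf_le _ Lh mh; rewrite /dist.
  rewrite (eq_ip_sqr P (F := fun w => F w - 2^-1 * (Y m w + Y n w))
    (F' := fun w => 2^-1 * ((F w - Y m w) + (F w - Y n w)))); last first.
    by move=> w; field.
  rewrite ipZl ?ipZr; [|exact: L2D|exact: L2D|exact: L2D|exact/L2Z/L2D].
  rewrite ip_sqrD//.
  rewrite (eq_ip_sqr P (F := fun w => Y m w - Y n w)
    (F' := fun w => (F w - Y n w) - (F w - Y m w))); last first.
    by move=> w; ring.
  rewrite (ip_sqrB Ln Lm) (ipC P (fun w => F w - Y n w) (fun w => F w - Y m w)).
  move: Dm Dn hm hn; rewrite /dist.
  by move: (m.+1%:R^-1) (n.+1%:R^-1) => p q; lra.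
exists Z; split => //; first exact: mZ.
move=> V LV mV; apply/eqP; rewrite -sqrf_eq0 eq_le sqr_ge0 andbT.
apply/ler_addgt0Pr => e e0; rewrite add0r.
pose a := ip V V; have a0 : 0 <= a := ip_ge0 P V.
have e1 : 0 < e / (4 * (a + 1)) by rewrite divr_gt0// mulr_gt0// ltr_wpDl.
have [N NZ] := YZ _ e1.
pose n := maxn N (Num.truncn (e / (4 * (a + 1)))^-1).+1.
have h1 : n.+1%:R^-1 < e / (4 * (a + 1)).
  rewrite invf_plt ?posrE//.
  rewrite (lt_le_trans (truncnS_gt _))// ler_nat.
  by rewrite leqW// leq_maxr.
have h2 := NZ n (leq_maxl _ _).
have L1 : L2 (fun w => F w - Y n w) by exact: L2B.
have L3 : L2 (fun w => Y n w - Z w) by exact: L2B.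
have -> : ip (fun w => F w - Z w) V =
    ip (fun w => F w - Y n w) V + ip (fun w => Y n w - Z w) V.
  by rewrite -ipDl//; apply: eq_ip => // w; rewrite subrKA.
have h3 := near_orth n V LV mV.
have h4 := cauchy_schwarz L3 LV.
set x := ip _ V in h3 *; set y := ip _ V in h4 *; rewrite -/a in h3 h4.
have h5 : x ^+ 2 <= e / 4.
  rewrite (le_trans h3)// (@le_trans _ _ (e / (4 * (a + 1)) * (a + 1)))//.
    by rewrite ler_pM//; [rewrite ltW|rewrite lerDl].
  by rewrite le_eqVlt; apply/orP; left; apply/eqP; field; rewrite gt_eqF// ltr_wpDl.
have h6 : y ^+ 2 <= e / 4.
  rewrite (le_trans h4)// (@le_trans _ _ (e / (4 * (a + 1)) * (a + 1)))//.
    by rewrite ler_pM//; [exact: ip_ge0|rewrite ltW|rewrite lerDl].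
  by rewrite le_eqVlt; apply/orP; left; apply/eqP; field; rewrite gt_eqF// ltr_wpDl.
have h7 : (x + y) ^+ 2 <= 2 * x ^+ 2 + 2 * y ^+ 2.
  by have := sqr_ge0 (x - y); rewrite sqrrB sqrrD; lra.
lra.
Qed.

(** The set [A] where D is nonnegative belongs to the sigma-algebra, so the
    integrals of D over [A] and its complement, hence of |D|, vanish. *)
Lemma ae0_integral_wrt D : measurable_wrt G D ->
  P.-integrable setT (EFin \o D) ->
  (forall A, <<s G >> A -> (\int[P]_(w in A) (D w)%:E = 0)%E) ->
  {ae P, forall w, D w = 0}.
Proof.
move=> mD iD D0; pose A := [set w | 0 <= D w].
have GA : <<s G >> A.
  have m0 : measurable_wrt G (cst 0 : T -> R) by exact: measurable_wrt_cst.
  have := @measurable_fun_ler _ (g_sigma_algebraType G) _ setT (cst 0) D m0 mD.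
  by move=> /(_ measurableT [set true] I); rewrite setTI; congr (<<s _ >> _); apply/seteqP.
have mA : measurable A := g_sigma_measurable GT GA.
have : (\int[P]_w `|(D w)%:E| = 0)%E.
  rewrite -(setvU A) ge0_integral_setU//=; last first.
  - by rewrite disj_set2E setICl.
  - rewrite setvU; apply/measurable_EFinP/measurableT_comp => //.
    exact: measurable_wrt_measurable mD.
  - exact: measurableC.
  rewrite (@eq_integral _ _ _ _ A (EFin \o D)); last first.
    by move=> w; rewrite inE/= => D0w; rewrite ger0_norm.
  rewrite (D0 _ GA) adde0.
  rewrite (@eq_integral _ _ _ _ (~` A) (fun w => (-1)%:E * (D w)%:E)%E); last first.
    move=> w; rewrite inE/= => /negP; rewrite -ltNge => D0w.
    by rewrite ltr0_norm// -EFinM mulN1r.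
  rewrite integralZl ?(D0 (~` A)) ?mule0//; last 2 first.
  - exact: measurableC.
  - by apply: integrableS iD => //; exact: measurableC.
  by apply: sigma_algebraC.
have mD' : measurable_fun setT (fun w => (D w)%:E).
  by apply/measurable_EFinP; exact: measurable_wrt_measurable mD.
move=> /(ae_eq_integral_abs P measurableT mD').
by apply: filterS => w /(_ I) [].
Qed.

Lemma is_cond_exp_projection F Z : L2 F -> L2 Z -> measurable_wrt G Z ->
  (forall Y, L2 Y -> measurable_wrt G Y -> ip (fun w => F w - Z w) Y = 0) ->
  is_cond_exp P G F Z.
Proof.
move=> LF LZ mZ FZ; split => //.
  exact: L2_integrable.
move=> A GA; have mA : measurable A := g_sigma_measurable GT GA.
rewrite !integral_ip_indic//; congr EFin; apply/esym/eqP; rewrite -subr_eq0 -ipBl ?FZ//.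
- exact: L2_indic.
- exact: measurable_wrt_indic.
- exact: L2_indic.
Qed.

(** [cond_exp] selects some integrable version; it agrees almost surely with the
    orthogonal projection, so it inherits square integrability and orthogonality
    to every square integrable [Y], not only to indicators. *)
Lemma cond_expP F : L2 F -> [/\ L2 (cond_exp P G F), measurable_wrt G (cond_exp P G F) &
  forall Y, L2 Y -> measurable_wrt G Y -> ip (fun w => F w - cond_exp P G F w) Y = 0].
Proof.
move=> LF; have [Z [LZ mZ FZ]] := L2_projection LF.
have [mC iC CF] : is_cond_exp P G F (cond_exp P G F).
  apply: xgetPex; exists Z; exact: is_cond_exp_projection.
have [_ iZ ZF] := is_cond_exp_projection LF LZ mZ FZ.
have mC' : measurable_fun setT (cond_exp P G F) := measurable_wrt_measurable GT mC.
have ZC : {ae P, forall w, Z w = cond_exp P G F w}.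
  have : {ae P, forall w, Z w - cond_exp P G F w = 0}.
    apply: ae0_integral_wrt; first exact: measurable_wrtB.
      by have := integrableB measurableT iZ iC; apply: eq_integrable.
    move=> A GA; have mA : measurable A := g_sigma_measurable GT GA.
    have iZA := integrableS measurableT mA (@subsetT _ _) iZ.
    have iCA := integrableS measurableT mA (@subsetT _ _) iC.
    under eq_integral do rewrite EFinB.
    rewrite integralB_EFin//= ZF// CF// subee//.
    by rewrite -CF//; exact: integrable_fin_num.
  by apply: filterS => w /subr0_eq.
have LC : L2 (cond_exp P G F) by exact: L2_ae ZC LZ.
split => // Y LY mY; rewrite -(FZ _ LY mY); apply: eq_ip_ae.
- exact/L2_measurable/L2B/LC.
- exact/L2_measurable/L2B/LZ.
- exact: L2_measurable LY.
- exact: L2_measurable LY.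
- by apply: filterS ZC => w ->.
- exact: aeW.
Qed.

End projection.

Section orthogonality.
Context (R : realType) d (T : measurableType d) (P : probability T R).
Context (G : set (set T)) (GT : G `<=` measurable).
Implicit Types (F Z Y : T -> R) (A : set T).

Local Notation ip := (ip P).
Local Notation L2 := (L2 P).

Lemma ip_cond_exp F Y : L2 F -> L2 Y -> measurable_wrt G Y ->
  ip (cond_exp P G F) Y = ip F Y.
Proof.
move=> LF LY mY; have [LC mC CF] := cond_expP GT LF.
by apply/esym/eqP; rewrite -subr_eq0 -ipBl// CF.
Qed.

Lemma L2_cond_exp F : L2 F -> L2 (cond_exp P G F).
Proof. by move=> /(cond_expP GT)[]. Qed.

Lemma measurable_cond_exp F : L2 F -> measurable_wrt G (cond_exp P G F).
Proof. by move=> /(cond_expP GT)[]. Qed.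

Lemma orthogonal_sigma_algebra F : setI_closed G -> G setT -> L2 F ->
  (forall A, G A -> ip F \1_A = 0) ->
  forall A, <<s G >> A -> ip F \1_A = 0.
Proof.
move=> IG TG LF F0.
have mG A : <<s G >> A -> measurable A by exact: g_sigma_measurable.
apply: (@dynkin_induction _ (g_sigma_algebraType G)) => //=.
- exact: F0.
- move=> A mA FA; have mA' := mG _ mA.
  rewrite (eq_ip P (F' := F) (G' := fun w => \1_setT w - \1_A w))//; last first.
    by move=> w; rewrite !indicE in_setC in_setT; case: (w \in A); rewrite /= ?subrr ?subr0.
  by rewrite ipBr//; [rewrite FA F0// subr0|exact: L2_indic..].
- move=> A mA tA FA; have mA' n := mG _ (mA n).
  apply: EFin_inj; rewrite -integral_ip_indic//; last exact: bigcup_measurable.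
  rewrite integral_bigcup//.
    rewrite eseries0// => n _ _; rewrite integral_ip_indic// FA//.
  apply: (integrableS measurableT) => //; first exact: bigcup_measurable.
  exact: L2_integrable.
Qed.

(** Orthogonality to a pi-system extends to the sigma-algebra that it generates
    by Dynkin's argument.  Then the projection of F onto the functions measurable
    for this sigma-algebra has null integral over all its events, so it is null. *)
Lemma orthogonal_L2 F : setI_closed G -> G setT -> L2 F ->
  (forall A, G A -> ip F \1_A = 0) ->
  forall Y, L2 Y -> measurable_wrt G Y -> ip F Y = 0.
Proof.
move=> IG TG LF F0 Y LY mY.
have LC := L2_cond_exp LF.
have C0 : {ae P, forall w, cond_exp P G F w = 0}.
  apply: (ae0_integral_wrt GT); first exact: measurable_cond_exp.
    exact: L2_integrable.
  move=> A GA; have mA := g_sigma_measurable GT GA.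
  rewrite integral_ip_indic// ip_cond_exp//.
  - by rewrite orthogonal_sigma_algebra.
  - exact: L2_indic.
  - exact: measurable_wrt_indic.
rewrite -ip_cond_exp// -(ip0l P Y); apply: eq_ip_ae => //.
- exact: L2_measurable LC.
- exact: L2_measurable LY.
- exact: L2_measurable LY.
- exact: aeW.
Qed.

(** Independence says that the centred indicator of [S] is orthogonal to a
    pi-system, hence to the square integrable functions measurable for it. *)
Lemma ip_indep Y S : setI_closed G -> G setT -> measurable S ->
  (forall A, G A -> P (A `&` S) = (P A * P S)%E) ->
  L2 Y -> measurable_wrt G Y -> ip Y \1_S = fine (P S) * ip Y (cst 1).
Proof.
move=> IG TG mS GS LY mY.
have LS : L2 \1_S := L2_indic P mS.
have L1 := L2_cst P 1.
have LPS := L2Z (fine (P S)) L1.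
have LW := L2B LS LPS.
apply/eqP; rewrite -subr_eq0 -ipZr// -ipBr// ipC; apply/eqP.
apply: orthogonal_L2 => // A GA; have mA := GT GA.
rewrite ipBl ?ipZl//; try exact: L2_indic.
rewrite (@eq_ip_mul _ _ _ _ _ _ (cst 1) \1_(A `&` S)); last first.
  by move=> w; rewrite indicI mul1r mulrC.
rewrite !ip1_indic//; last exact: measurableI.
rewrite GS// fineM ?fin_num_measure//.
by rewrite mulrC subrr.
Qed.

End orthogonality.

(** * Rectangles and sigma-algebras of coordinates *)

Section coordinates.
Context (R : realType) (d : nat -> measure_display)
  (E : forall n, measurableType (d n)) dO (Omega : measurableType dO).
Implicit Types (X : {mfun Omega >-> seqspace E}) (M L : set nat).

Definition rectangle X (A : forall i, set (E i)) : set Omega :=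
  [set w | forall i, A i (X w i)].

(** The finite-dimensional rectangles over the coordinates in M, given by a whole
    sequence of sides of which only finitely many, all with index in M, are
    proper: intersections are then taken side by side. *)
Definition rectangles X M : set (set Omega) :=
  [set S | exists A : forall i, set (E i),
    [/\ forall i, measurable (A i), forall i, ~ M i -> A i = setT,
        exists n, forall i, (n <= i)%N -> A i = setT & S = rectangle X A]].

Lemma measurable_coord j : measurable_fun setT (fun x : seqspace E => x j).
Proof.
move=> _ B mB; rewrite setTI; apply: sub_gen_smallest; exists j => //.
by exists B => //; exact: setTI.
Qed.

Lemma measurable_box (A : forall i, set (E i)) : (forall i, measurable (A i)) ->
  measurable [set x : seqspace E | forall i, A i (x i)].
Proof.
move=> mA.
rewrite (_ : [set x | _] = \bigcap_i ((fun x : seqspace E => x i) @^-1` A i)).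
  apply: bigcapT_measurable => i.
  by rewrite -[X in measurable X]setTI; exact: measurable_coord.
by apply/seteqP; split => x h i; [move=> _; exact: h|exact: (h i I)].
Qed.

Lemma rectangle_setI X A B :
  rectangle X A `&` rectangle X B = rectangle X (fun i => A i `&` B i).
Proof.
apply/seteqP; split => w; first by move=> [Aw Bw] i.
by move=> ABw; split => i; case: (ABw i).
Qed.

Lemma rectangles_setI_closed X M : setI_closed (rectangles X M).
Proof.
move=> _ _ [A [mA AM [n An] ->]] [B [mB BM [m Bm] ->]].
exists (fun i => A i `&` B i); split; last exact: rectangle_setI.
- by move=> i; exact: measurableI.
- by move=> i Mi; rewrite AM// BM// setIT.
- by exists (maxn n m) => i; rewrite geq_max => /andP[ni mi]; rewrite An// Bm// setIT.
Qed.

Lemma rectanglesT X M : rectangles X M setT.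
Proof.
exists (fun=> setT); split => //; first by exists 0%N.
by apply/seteqP.
Qed.

Lemma rectanglesS X L M : L `<=` M -> rectangles X L `<=` rectangles X M.
Proof.
move=> LM _ [A [mA AM An ->]]; exists A; split => // i Mi.
by apply: AM => /LM.
Qed.

Lemma sub_rectangles_coord_gen X M : rectangles X M `<=` <<s coord_gen X M >>.
Proof.
move=> _ [A [mA AM _ ->]].
rewrite (_ : rectangle X A = \bigcap_i [set w | A i (X w i)]); last first.
  by apply/seteqP; split => w h i; [move=> _; exact: h|exact: (h i I)].
apply: (@bigcap_measurable _ (g_sigma_algebraType (coord_gen X M))) => // i _.
have [Mi|Mi] := pselect (M i); last first.
  by rewrite AM//; exact: (@measurableT _ (g_sigma_algebraType (coord_gen X M))).
apply: sub_gen_smallest; exists i => //.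
by exists (A i) => //; rewrite setTI.
Qed.

Lemma coord_gen_sub_rectangles X M : coord_gen X M `<=` rectangles X M.
Proof.
move=> _ [j Mj [B mB <-]]; exists (dfwith (fun i => setT : set (E i)) j B); split.
- by move=> i; case: dfwithP.
- by move=> i Mi; rewrite dfwithout//; apply: contra_notN Mi => /eqP <-.
- by exists j.+1 => i ji; rewrite dfwithout// ltn_eqF.
- rewrite setTI; apply/seteqP; split => w.
    by move=> Bw i; case: dfwithP.
  by move=> /(_ j); rewrite dfwithin.
Qed.

(** Rectangles are a generating pi-system, which makes every statement about
    [coord_gen X M] below a statement about finite products. *)
Lemma g_sigma_rectangles X M : <<s rectangles X M >> = <<s coord_gen X M >>.
Proof.
apply/seteqP; split; apply: smallest_sub; try exact: smallest_sigma_algebra.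
  exact: sub_rectangles_coord_gen.
exact: subset_trans (@coord_gen_sub_rectangles X M) (@sub_gen_smallest _ _ _).
Qed.

Lemma coord_gen_measurable X M : coord_gen X M `<=` measurable.
Proof.
move=> _ [j Mj [B mB <-]].
have mBj : measurable [set x : seqspace E | B (x j)].
  apply: sub_gen_smallest; exists j => //; exists B => //; exact: setTI.
exact: (measurable_funP X measurableT _ mBj).
Qed.

Lemma rectangles_measurable X M : rectangles X M `<=` measurable.
Proof.
move=> S /sub_rectangles_coord_gen; exact/g_sigma_measurable/coord_gen_measurable.
Qed.

Lemma measurable_wrt_rectangles X M (F : Omega -> R) :
  measurable_wrt (coord_gen X M) F <-> measurable_wrt (rectangles X M) F.
Proof. by split; apply: measurable_wrtS; rewrite g_sigma_rectangles. Qed.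

Lemma coord_genS X L M : L `<=` M -> <<s coord_gen X L >> `<=` <<s coord_gen X M >>.
Proof.
move=> LM; rewrite -!g_sigma_rectangles.
apply: smallest_sub; first exact: smallest_sigma_algebra.
exact: subset_trans (rectanglesS LM) (@sub_gen_smallest _ _ _).
Qed.

End coordinates.

Section rectangle_orthogonality.
Context (R : realType) (d : nat -> measure_display)
  (E : forall n, measurableType (d n)) dO (Omega : measurableType dO)
  (P : probability Omega R) (X : {mfun Omega >-> seqspace E}) (M : set nat).
Implicit Types (F Y : Omega -> R) (S : set Omega).

(** Identities between projections thus reduce to finite products of sides. *)
Lemma orthogonal_rectangles F Y : L2 P F ->
  (forall A, rectangles X M A -> ip P F \1_A = 0) ->
  L2 P Y -> measurable_wrt (coord_gen X M) Y -> ip P F Y = 0.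
Proof.
move=> LF F0 LY /measurable_wrt_rectangles mY.
apply: (orthogonal_L2 (@rectangles_measurable _ _ _ _ X M)) LY mY => //.
- exact: rectangles_setI_closed.
- exact: rectanglesT.
Qed.

Lemma ip_indep_rectangles Y S : measurable S ->
  (forall A, rectangles X M A -> P (A `&` S) = (P A * P S)%E) ->
  L2 P Y -> measurable_wrt (coord_gen X M) Y ->
  ip P Y \1_S = fine (P S) * ip P Y (cst 1).
Proof.
move=> mS indS LY /measurable_wrt_rectangles mY.
apply: (ip_indep (@rectangles_measurable _ _ _ _ X M)) mS indS LY mY.
- exact: rectangles_setI_closed.
- exact: rectanglesT.
Qed.

Lemma L2_cond_exp_coord F : L2 P F -> L2 P (cond_exp P (coord_gen X M) F).
Proof. by apply: L2_cond_exp; exact: coord_gen_measurable. Qed.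

Lemma measurable_cond_exp_coord F : L2 P F ->
  measurable_wrt (coord_gen X M) (cond_exp P (coord_gen X M) F).
Proof. by apply: measurable_cond_exp; exact: coord_gen_measurable. Qed.

Lemma ip_cond_exp_coord F Y : L2 P F -> L2 P Y ->
  measurable_wrt (coord_gen X M) Y ->
  ip P (cond_exp P (coord_gen X M) F) Y = ip P F Y.
Proof. by apply: ip_cond_exp; exact: coord_gen_measurable. Qed.

End rectangle_orthogonality.

(** * Projections onto functions of independent coordinates *)

Section product.
Context (R : realType) (d : nat -> measure_display)
  (E : forall n, measurableType (d n)) (mu_ : forall n, probability (E n) R)
  (mu : probability (seqspace E) R) (mu_prod : is_product_measure mu_ mu)
  dO (Omega : measurableType dO) (P : probability Omega R)
  (X : {mfun Omega >-> seqspace E})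
  (X_mu : forall A, measurable A -> distribution P X A = mu A).
Implicit Types (M L : set nat) (F Y : Omega -> R) (S : set Omega).

Local Notation ip := (ip P).
Local Notation L2 := (L2 P).
Local Notation FF := (coord_gen X).
Local Notation T M F := (cond_exp P (coord_gen X M) F).

(** The product runs over any range that covers the proper sides, so that two
    rectangles can be compared over a common range. *)
Lemma probability_rectangle n (A : forall i, set (E i)) :
  (forall i, measurable (A i)) -> (forall i, (n <= i)%N -> A i = setT) ->
  P (rectangle X A) = (\prod_(i < n) mu_ i (A i))%E.
Proof.
move=> mA An; rewrite -mu_prod//; transitivity (mu [set x | forall i, A i (x i)]).
  by rewrite -X_mu//; exact: measurable_box.
congr (mu _); apply/seteqP; split => x h i; first by move=> _; exact: h.
by have [ni|ni] := leqP n i; [rewrite An|exact: h].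
Qed.

(** In each coordinate one of the two sides is the whole space. *)
Lemma rectangles_indep L M S S' : (forall i, L i -> ~ M i) ->
  rectangles X L S -> rectangles X M S' -> P (S `&` S') = (P S * P S')%E.
Proof.
move=> LM [A [mA AL [n An] ->]] [B [mB BM [m Bm] ->]].
rewrite rectangle_setI.
have Anm i : (maxn n m <= i)%N -> A i = setT by rewrite geq_max => /andP[/An].
have Bnm i : (maxn n m <= i)%N -> B i = setT by rewrite geq_max => /andP[_ /Bm].
rewrite (probability_rectangle mA Anm) (probability_rectangle mB Bnm).
rewrite (@probability_rectangle (maxn n m)); last 2 first.
- by move=> i; exact: measurableI.
- by move=> i h; rewrite Anm// Bnm// setIT.
rewrite -big_split/=; apply: eq_bigr => i _.
have [Li|Li] := pselect (L i).
  by rewrite (BM i)// ?setIT ?probability_setT ?mule1//; exact: LM.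
by rewrite AL// setTI probability_setT mul1e.
Qed.

Lemma ip_indep_indic L M Y S : (forall i, L i -> ~ M i) ->
  L2 Y -> measurable_wrt (FF L) Y -> rectangles X M S ->
  ip Y \1_S = fine (P S) * ip Y (cst 1).
Proof.
move=> LM LY mY MS; apply: (ip_indep_rectangles (X := X) (M := L)) => //.
  exact: rectangles_measurable MS.
by move=> A LA; exact: rectangles_indep LA MS.
Qed.

Lemma rectangles_split L M S : rectangles X M S -> exists S1 S2,
  [/\ rectangles X (L `&` M) S1, rectangles X (M `\` L) S2 & S = S1 `&` S2].
Proof.
move=> [A [mA AM [n An] ->]].
pose A1 i := if pselect (L i) then A i else setT.
pose A2 i := if pselect (L i) then setT else A i.
exists (rectangle X A1), (rectangle X A2); split.
- exists A1; split => //; rewrite /A1.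
  + by move=> i; case: (pselect (L i)) => h /=.
  + by move=> i LMi; case: (pselect (L i)) => //= Li; apply: AM => Mi; exact: LMi.
  + by exists n => i /An h; case: (pselect (L i)).
- exists A2; split => //; rewrite /A2.
  + by move=> i; case: (pselect (L i)) => h /=.
  + by move=> i LMi; case: (pselect (L i)) => //= Li; apply: AM => Mi; exact: LMi.
  + by exists n => i /An h; case: (pselect (L i)).
- rewrite rectangle_setI; congr rectangle.
  apply: functional_extensionality_dep => i; rewrite /A1 /A2.
  by case: (pselect (L i)) => h /=; rewrite ?setIT ?setTI.
Qed.

(** On a rectangle over M, the sides outside L are independent of Y and of
    T_(L /\ M) Y and factor out; on the sides inside L both have the same integral.
    So T_M Y = T_(L /\ M) Y for every function Y of the coordinates in L; the
    identity is tested against functions of those in M. *)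
Lemma cond_exp_commute L M Y : L2 Y -> measurable_wrt (FF L) Y ->
  forall V, L2 V -> measurable_wrt (FF M) V -> ip (T (L `&` M) Y) V = ip Y V.
Proof.
move=> LY mY V LV mV.
have sKL : <<s FF (L `&` M) >> `<=` <<s FF L >> by apply: coord_genS; exact: subIsetl.
have LTY : L2 (T (L `&` M) Y) by exact: L2_cond_exp_coord.
have mTY : measurable_wrt (FF (L `&` M)) (T (L `&` M) Y).
  exact: measurable_cond_exp_coord.
have mTYL := measurable_wrtS sKL mTY.
have LD := L2B LY LTY; have mD := measurable_wrtB mY mTYL.
apply/esym/eqP; rewrite -subr_eq0 -ipBl//; apply/eqP.
apply: (orthogonal_rectangles LD _ LV mV) => S /(rectangles_split L)[S1 [S2 [RS1 RS2 ->]]].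
have mS1 := rectangles_measurable RS1; have mS2 := rectangles_measurable RS2.
have GS1 : measurable_wrt (FF (L `&` M)) (\1_S1 : Omega -> R).
  by apply: measurable_wrt_indic; exact: sub_rectangles_coord_gen.
rewrite (@eq_ip_mul _ _ _ _ _ _ (fun w => (Y w - T (L `&` M) Y w) * \1_S1 w) \1_S2); last first.
  by move=> w; rewrite indicI mulrA.
rewrite (@ip_indep_indic L (M `\` L))//; last 3 first.
- by move=> i Li [].
- exact: L2_mul_indic.
- by apply: measurable_wrtM => //; exact: measurable_wrtS GS1.
rewrite (@eq_ip_mul _ _ _ _ _ (cst 1) (fun w => Y w - T (L `&` M) Y w) \1_S1); last first.
  by move=> w; rewrite mulr1.
have LS1 := L2_indic P mS1.
by rewrite ipBl// (ip_cond_exp_coord LY LS1 GS1) subrr mulr0.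
Qed.

(** Both sides equal <T_L F, T_(L /\ M) F>, by [cond_exp_commute] on the left and
    the projection property on the right. *)
Lemma gram_cond_exp L M F : L2 F ->
  ip (T L F) (T M F) = ip (T (L `&` M) F) (T (L `&` M) F).
Proof.
move=> LF; set K := L `&` M; set Y := T L F.
have [LL LM LK] : [/\ L2 (T L F), L2 (T M F) & L2 (T K F)] by split; exact: L2_cond_exp_coord.
have mL : measurable_wrt (FF L) (T L F) by exact: measurable_cond_exp_coord.
have mM : measurable_wrt (FF M) (T M F) by exact: measurable_cond_exp_coord.
have mK : measurable_wrt (FF K) (T K F) by exact: measurable_cond_exp_coord.
have LKY : L2 (T K Y) by exact: L2_cond_exp_coord.
have mKY : measurable_wrt (FF K) (T K Y) by exact: measurable_cond_exp_coord.
have sKL : <<s FF K >> `<=` <<s FF L >> by apply: coord_genS; exact: subIsetl.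
have sKM : <<s FF K >> `<=` <<s FF M >> by apply: coord_genS; exact: subIsetr.
rewrite -(cond_exp_commute LL mL LM mM) -/K -/Y.
have mKYM := measurable_wrtS sKM mKY; have mKL := measurable_wrtS sKL mK.
rewrite ipC (ip_cond_exp_coord (M := M) LF LKY mKYM) -(ip_cond_exp_coord (M := K) LF LKY mKY).
rewrite ipC (ip_cond_exp_coord (M := K) LL LK mK).
by rewrite (ip_cond_exp_coord (M := L) LF LK mKL) -(ip_cond_exp_coord LF LK mK).
Qed.

End product.

(** * The measures on sigma(X) and on N x sigma(X) *)

Section restriction.
Context (R : realType) (d : nat -> measure_display)
  (E : forall n, measurableType (d n)) dO (Omega : measurableType dO)
  (P : probability Omega R) (X : {mfun Omega >-> seqspace E}).
Implicit Types (F : Omega -> R) (U : nat -> Omega -> R).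

Local Notation FX := (coord_gen X setT).
Local Notation OX := (Omega_X X).

Lemma coord_genT : <<s FX >> = preimage_set_system setT X measurable.
Proof.
rewrite -[RHS](g_sigma_preimageE setT X (@cylinders _ E)); congr <<s _ >>.
apply/seteqP; split => [_ [j _ [B mB <-]]|_ [_ [j _ [B mB <-]] <-]].
  by eexists; [exists j => //; exists B => //; reflexivity|rewrite !setTI].
by exists j => //; exists B => //; rewrite !setTI.
Qed.

Lemma measurable_Omega_X F :
  measurable_fun setT (F : OX -> R) <-> measurable_wrt FX F.
Proof.
split => mF _ B mB.
  have := mF measurableT B mB; rewrite /measurable/=.
  by rewrite [X in _ -> X](_ : _ = <<s FX >> (setT `&` F @^-1` B))// coord_genT.
have : <<s FX >> (setT `&` F @^-1` B) by exact: (mF measurableT B mB).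
by rewrite coord_genT.
Qed.

Lemma ge0_integral_P_X (f : Omega -> \bar R) :
  measurable_fun setT (f : OX -> \bar R) -> (forall w, 0 <= f w)%E ->
  (\int[P_X P X]_w f w = \int[P]_w f w)%E.
Proof.
move=> mf f0; rewrite ge0_integral_pushforward//; exact: measurable_id_X.
Qed.

Lemma L2_P_X F : measurable_wrt FX F -> L2 (P_X P X) (F : OX -> R) <-> L2 P F.
Proof.
move=> mF; have mF' := (measurable_Omega_X F).2 mF.
have mF2 : measurable_fun setT ((fun w => (F w ^+ 2)%:E) : OX -> \bar R).
  exact/measurable_EFinP/measurable_funX.
split => [/L2_lty|/L2_lty] Foo; apply: L2_sqr_lty => //.
- by apply: measurable_wrt_measurable mF; exact: coord_gen_measurable.
- by rewrite -ge0_integral_P_X// => w; rewrite lee_fin sqr_ge0.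
- by rewrite ge0_integral_P_X// => w; rewrite lee_fin sqr_ge0.
Qed.

(** The space L2(sigma(X)) is defined through the image of P under the identity
    map to (Omega, sigma(X)); this lemma describes it inside L2(P). *)
Lemma L2_XP F : L2_X P X F <-> L2 P F /\ measurable_wrt FX F.
Proof.
split=> [LF|[LF mF]]; last exact: (L2_P_X mF).2.
have mF : measurable_wrt FX F by apply/measurable_Omega_X; exact: (L2_measurable LF).
by split => //; exact: (L2_P_X mF).1.
Qed.

Lemma ip_P_X F : measurable_wrt FX F -> ip (P_X P X) F F = ip P F F.
Proof.
move=> /measurable_Omega_X mF; congr fine; rewrite ge0_integral_P_X//.
  exact/measurable_EFinP/measurable_funM.
by move=> w; rewrite lee_fin -expr2 sqr_ge0.
Qed.

Lemma Lnorm_P_X_lt F e : 0 < e -> L2 P F -> measurable_wrt FX F ->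
  ('N[P_X P X]_2%:E [(fun w : OX => (F w)%:E)] < e%:E)%E = (ip P F F < e ^+ 2).
Proof.
move=> e0 LF mF; rewrite (@Lnorm_lt _ _ _ (P_X P X) F)//; last exact/L2_P_X.
by rewrite ip_P_X.
Qed.

(** The first factor is countable and discrete. *)
Lemma measurable_fun_countable_fst U :
  (forall k, measurable_wrt FX (U k)) <->
  measurable_fun setT (fun q : nat * OX => U q.1 q.2).
Proof.
split=> [mU _ B mB|mU k]; last first.
  apply/measurable_Omega_X.
  exact: (measurableT_comp mU
    (measurable_fun_pair (measurable_cst k) (@measurable_id _ OX setT))).
rewrite setTI (_ : _ @^-1` B = \bigcup_k ([set k] `*` (U k @^-1` B))).
  apply: bigcupT_measurable => k; apply: measurableX => //.
  have := (measurable_Omega_X _).2 (mU k) measurableT B mB.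
  by rewrite setTI.
apply/seteqP; split => [[k w] /= Bkw|[k w] [_ _ [/= -> Bw]]//].
by exists k.
Qed.

(** Tonelli's theorem takes both factors as sigma-finite measures. *)
HB.instance Definition _ := @Measure_isSigmaFinite.Build _ _ _ (@counting nat R)
  (sigma_finite_counting R).

(** Tonelli's theorem, the integral over the counting measure being a series. *)
Lemma ge0_integral_kappaP U : (forall k, measurable_wrt FX (U k)) ->
  (\int[kappaP P X]_q (U q.1 q.2 ^+ 2)%:E =
   \sum_(0 <= k <oo) \int[P]_w (U k w ^+ 2)%:E)%E.
Proof.
move=> mU; rewrite (@fubini_tonelli1 _ _ _ _ _ (@counting nat R) (P_X P X)
  (fun q => (U q.1 q.2 ^+ 2)%:E)).
- rewrite ge0_integral_count; last first.
    by move=> k; apply: integral_ge0 => w _; rewrite lee_fin sqr_ge0.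
  apply: eq_eseriesr => k _; rewrite /fubini_F/= ge0_integral_P_X//.
    exact/measurable_EFinP/measurable_funX/measurable_Omega_X.
  by move=> w; rewrite lee_fin sqr_ge0.
- exact/measurable_EFinP/measurable_funX/measurable_fun_countable_fst.
- by move=> q; rewrite lee_fin sqr_ge0.
Qed.

Lemma L2_kappaPP U : L2_kappaP P X U <->
  (forall k, measurable_wrt FX (U k)) /\
  (\sum_(0 <= k <oo) \int[P]_w (U k w ^+ 2)%:E < +oo)%E.
Proof.
rewrite /L2_kappaP/= Lfun2P; split => [[/measurable_fun_countable_fst mU]|[mU]].
  by rewrite ge0_integral_kappaP.
by rewrite ge0_integral_kappaP// -measurable_fun_countable_fst.
Qed.

Lemma Lnorm_kappaP_lt U e : 0 < e -> (forall k, measurable_wrt FX (U k)) ->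
  ('N[kappaP P X]_2%:E [(fun q => (U q.1 q.2)%:E)] < e%:E)%E =
  (\sum_(0 <= k <oo) \int[P]_w (U k w ^+ 2)%:E < (e ^+ 2)%:E)%E.
Proof.
by move=> e0 mU; rewrite (Lnorm2_lt (kappaP P X) (fun q => U q.1 q.2))// ge0_integral_kappaP.
Qed.

End restriction.

(** * Alternating sums over finite sets *)

Section moebius.
Context (R : realType).
Implicit Types (K L M : {fset nat}) (k : nat).
Local Open Scope fset_scope.

(** The involution behind the cancellations in alternating sums: it changes the
    parity of the cardinality and nothing but the membership of k. *)
Definition toggle k L := if k \in L then L `\ k else k |` L.

Lemma toggleK k : involutive (toggle k).
Proof.
move=> L; rewrite /toggle; have [kL|kL] := boolP (k \in L).
  by rewrite !inE eqxx/= fsetD1K.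
by rewrite !inE eqxx/= fsetU1K.
Qed.

Lemma toggle_sub k L M : k \in M -> (toggle k L `<=` M) = (L `<=` M).
Proof.
move=> kM; rewrite /toggle; case: ifPn => kL; last by rewrite fsubUset fsub1set kM.
by rewrite fsubDset fsetUC (fsetUidPl _ _ _)// fsub1set.
Qed.

Lemma sum_toggle0 k (s : {fset {fset nat}}) (f : {fset nat} -> R) :
  (forall L, L \in s -> toggle k L \in s) ->
  (forall L, L \in s -> f (toggle k L) = - f L)%R ->
  \sum_(L <- s) f L = 0%R.
Proof.
move=> sk fk.
have E : \sum_(L <- s) f L = - \sum_(L <- s) f L.
  rewrite -sumrN; transitivity (\sum_(L <- [seq toggle k L | L <- s]) f L); last first.
    by rewrite big_map big_seq [RHS]big_seq; apply: eq_bigr => L Ls; rewrite fk.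
  apply: perm_big; apply: uniq_perm; rewrite ?fset_uniq//.
    by rewrite map_inj_uniq ?fset_uniq//; exact: (inv_inj (toggleK k)).
  move=> L; apply/idP/mapP => [Ls|[L' L's ->]]; last exact: sk.
  by exists (toggle k L); [exact: sk|rewrite toggleK].
by move: E; move: (\sum_(_ <- _) _) => x; lra.
Qed.

Lemma signB m n : (n <= m)%N -> ((-1) ^+ (m - n) = (-1) ^+ m * (-1) ^+ n :> R)%R.
Proof. by move=> nm; rewrite -signr_odd oddB// signr_addb !signr_odd. Qed.

Lemma sign_toggle k L : ((-1) ^+ #|` toggle k L| = - (-1) ^+ #|` L| :> R)%R.
Proof.
rewrite /toggle; case: ifPn => kL; last by rewrite cardfsU1 kL exprS mulN1r.
by rewrite [in RHS](cardfsD1 k L) kL exprS mulN1r opprK.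
Qed.

(** After exchanging the sums, the coefficient of [g K] is an alternating sum over
    the sets between K and M, which cancels under [toggle k] for any k in M \ K
    and is 1 when K = M. *)
Lemma moebius_inversion (g : {fset nat} -> R) M :
  \sum_(L <- fpowerset M) \sum_(K <- fpowerset L)
    ((-1) ^+ (#|` L| - #|` K|) * g K)%R = g M.
Proof.
have -> : \sum_(L <- fpowerset M) \sum_(K <- fpowerset L)
    ((-1) ^+ (#|` L| - #|` K|) * g K)%R =
  \sum_(L <- fpowerset M) \sum_(K <- fpowerset M | K `<=` L)
    ((-1) ^+ (#|` L| - #|` K|) * g K)%R.
  rewrite big_seq [RHS]big_seq; apply: eq_bigr => L; rewrite fpowersetE => LM.
  rewrite -[RHS]big_filter; apply: perm_big; apply: uniq_perm.
  - exact: fset_uniq.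
  - by rewrite filter_uniq// fset_uniq.
  - move=> K; rewrite mem_filter !fpowersetE; apply/idP/andP => [KL|[]//].
    by split => //; exact: fsubset_trans LM.
rewrite (exchange_big_dep predT)//=.
have MM : M \in fpowerset M by rewrite fpowersetE.
rewrite (bigD1_seq M)//= ?fset_uniq// [X in (_ + X)%R]big1_seq.
  rewrite addr0 big_mkcond (bigD1_seq M)//= ?fset_uniq// fsubset_refl subnn expr0 mul1r.
  rewrite big1_seq ?addr0// => L /andP[LM]; rewrite fpowersetE => LsM.
  by case: ifPn => // ML; move: LM; rewrite eqEfsubset LsM ML.
move=> K /andP[KM]; rewrite fpowersetE => KsM.
have /fsubsetPn[k kM kK] : ~~ (M `<=` K).
  by apply: contra KM => MK; rewrite eqEfsubset KsM.
have KtL L : (K `<=` toggle k L) = (K `<=` L).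
  rewrite /toggle; case: ifPn => kL; first by rewrite fsubsetD1 kK andbT.
  apply/fsubsetP/fsubsetP => KL x xK; last by rewrite in_fset1U KL// orbT.
  have := KL x xK; rewrite in_fset1U => /predU1P[xk|//].
  by rewrite -xk xK in kK.
rewrite big_mkcond (@sum_toggle0 k)// => L; rewrite !fpowersetE ?toggle_sub// => LM.
rewrite KtL; case: ifPn => KL; last by rewrite oppr0.
rewrite !signB ?sign_toggle; first by rewrite !mulNr.
- exact: fsubset_leq_card.
- by rewrite fsubset_leq_card// KtL.
Qed.

End moebius.

Section exhaustion.
Context (R : realType).

Definition initial n : {fset nat} := [fset i in iota 0 n]%fset.

Lemma mem_initial n i : (i \in initial n) = (i < n)%N.
Proof. by rewrite !inE mem_iota. Qed.

Lemma set_initial n : [set` initial n] = `I_n.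
Proof. by apply/seteqP; split => i /=; rewrite mem_initial. Qed.

Lemma initial_sub m n : (m <= n)%N -> (initial m `<=` initial n)%fset.
Proof.
by move=> mn; apply/fsubsetP => i; rewrite !mem_initial => /leq_trans; exact.
Qed.

Lemma exhaust_fset (M : {fset nat}) : exists n, (M `<=` initial n)%fset.
Proof.
exists (\max_(i <- M) i).+1; apply/fsubsetP => i iM.
by rewrite mem_initial ltnS (big_rem i)//= leq_maxl.
Qed.

Lemma exhaust_fset_fset (J : {fset {fset nat}}) :
  exists n, (J `<=` fpowerset (initial n))%fset.
Proof.
have /choice[f fP] := exhaust_fset.
exists (\max_(M <- J) f M); apply/fsubsetP => M MJ.
rewrite fpowersetE (fsubset_trans (fP M))// initial_sub//.
by rewrite (big_rem M)//= leq_maxl.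
Qed.

(** The power sets of {0, ..., n-1} are cofinal among the finite families of
    finite sets, so a sum over all finite sets is a limit along n. *)
Lemma esum_exhaust (b : {fset nat} -> R) (l : R) :
  (forall M, 0 <= b M) ->
  (forall n, \sum_(M <- fpowerset (initial n)) b M <= l) ->
  (forall e, 0 < e -> exists n, l - e < \sum_(M <- fpowerset (initial n)) b M) ->
  (\esum_(M in [set: {fset nat}]) (b M)%:E = l%:E)%E.
Proof.
move=> b0 bl lb; apply/eqP; rewrite eq_le; apply/andP; split.
  apply: ge_ereal_sup => _ [S [finS _] <-].
  have [n Sn] := exhaust_fset_fset (fset_set S).
  rewrite fsbig_finite//= sumEFin lee_fin (le_trans _ (bl n))//.
  rewrite [leRHS](big_fsetID _ (mem (fset_set S)))/=.
  rewrite [X in _ <= X + _](_ : _ = \sum_(M <- fset_set S) b M).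
    by rewrite lerDl sumr_ge0.
  apply: eq_fbigl => M; rewrite !inE/=; apply/andP/idP => [[]//|MS]; split => //.
  exact: (fsubsetP Sn).
apply/lee_addgt0Pr => e e0; have [n ln] := lb e e0.
rewrite -leeBlDr// -EFinB (@le_trans _ _ (\sum_(M <- fpowerset (initial n)) b M)%:E)//.
  by rewrite lee_fin ltW.
apply: esum_ge; exists [set` fpowerset (initial n)]; first by split.
by rewrite fsbig_finite//= set_fsetK sumEFin.
Qed.

End exhaustion.

(** * The Hoeffding decomposition *)

Section hoeffding_decomposition.
Context (R : realType) (d : nat -> measure_display)
  (E : forall n, measurableType (d n)) (mu_ : forall n, probability (E n) R)
  (mu : probability (seqspace E) R) (mu_prod : is_product_measure mu_ mu)
  dO (Omega : measurableType dO) (P : probability Omega R)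
  (X : {mfun Omega >-> seqspace E})
  (X_mu : forall A, measurable A -> distribution P X A = mu A).
Context (F : Omega -> R) (LF : L2 P F).
Implicit Types (L : set nat) (Y : Omega -> R) (S : set Omega).

Local Notation ip := (ip P).
Local Notation L2 := (L2 P).
Local Notation FF := (coord_gen X).
Local Notation T M := (cond_exp P (coord_gen X M) F).
Local Notation q M := (ip (T M) (T M)).

Let LT L : L2 (T L). Proof. exact: L2_cond_exp_coord. Qed.
Let mT L : measurable_wrt (FF L) (T L). Proof. exact: measurable_cond_exp_coord. Qed.
Let gram L L' : ip (T L) (T L') = q (L `&` L').
Proof. exact: (gram_cond_exp mu_prod X_mu). Qed.

Lemma ip_sqr_cond_expB (L M : set nat) : L `<=` M ->
  ip (fun w => T M w - T L w) (fun w => T M w - T L w) = q M - q L.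
Proof.
by move=> LM; rewrite ip_sqrB// (gram M L) setIidr//; ring.
Qed.

Lemma ip_sqr_cond_exp_le (L M : set nat) : L `<=` M -> q L <= q M.
Proof. by move=> LM; rewrite -subr_ge0 -ip_sqr_cond_expB// ip_ge0. Qed.

Lemma ip_cond_exp_self (M : set nat) : ip F (T M) = q M.
Proof. by rewrite -(ip_cond_exp_coord LF (LT M) (@mT M)). Qed.

Lemma ip_sqr_cond_exp_le_ip (M : set nat) : q M <= ip F F.
Proof.
have := ip_ge0 P (fun w => F w - T M w).
by rewrite ip_sqrB// ip_cond_exp_self; lra.
Qed.

(** The martingale T_(M /\ n) F converges in L2 because its squared norms increase
    and are bounded.  Its limit S and T_M F have the same integral over every
    rectangle over M, as such a rectangle only involves finitely many
    coordinates, so S = T_M F. *)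
Lemma ip_sqr_cond_exp_cvg (M : set nat) e : 0 < e ->
  exists N, forall n, (N <= n)%N -> q M - q (M `&` `I_n) < e.
Proof.
move=> e0; pose Mn n := M `&` `I_n.
have Mn_homo m n : (m <= n)%N -> Mn m `<=` Mn n.
  by move=> mn i [Mi im]; split => //; exact: leq_trans mn.
have Mn_sub n : Mn n `<=` M by exact: subIsetl.
have [S [LS mS TS]] : exists S : Omega -> R,
    [/\ L2 S,
      forall G : set (set Omega), (forall n, measurable_wrt G (T (Mn n))) ->
        measurable_wrt G S &
      forall e, 0 < e -> exists N, forall n, (N <= n)%N ->
        ip (fun w => T (Mn n) w - S w) (fun w => T (Mn n) w - S w) < e].
  apply: riesz_fischer => // r r0.
  pose c n := q (Mn n).
  have cv : cvgn c.
    apply: nondecreasing_is_cvgn; first by move=> m n mn; exact/ip_sqr_cond_exp_le/Mn_homo.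
    by exists (ip F F) => _ [n _ <-]; exact: ip_sqr_cond_exp_le_ip.
  have /cvgrPdist_lt/(_ _ (divr_gt0 r0 (ltr0Sn _ 1)))[N _ HN] :
    c n @[n --> \oo] --> limn c by [].
  exists N.
  have main m n : (N <= m)%N -> (m <= n)%N ->
      ip (fun w => T (Mn n) w - T (Mn m) w) (fun w => T (Mn n) w - T (Mn m) w) < r.
    move=> Nm mn; rewrite ip_sqr_cond_expB; last exact: Mn_homo.
    have := HN m Nm; have := HN n (leq_trans Nm mn); rewrite /c/= !ltr_norml.
    by move=> /andP[h1 h2] /andP[h3 h4]; lra.
  move=> m n Nm Nn; have [mn|nm] := leqP m n; last exact/main/ltnW.
  rewrite ip_sqrB// ipC; have := main _ _ Nm mn.
  by rewrite ip_sqrB//; lra.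
have {}mS : measurable_wrt (FF M) S.
  by apply: mS => n; apply: measurable_wrtS (@mT _); exact: coord_genS.
have LTS : L2 (fun w => T M w - S w) by exact: L2B.
have LTnS n : L2 (fun w => T (Mn n) w - S w) by exact: L2B.
have TS0 : ip (fun w => T M w - S w) (fun w => T M w - S w) = 0.
  apply: (orthogonal_rectangles LTS _ LTS (measurable_wrtB (@mT M) mS)) => A MA.
  have mA := rectangles_measurable MA; have LA := L2_indic P mA.
  have [n0 An0] : exists n0, forall n, (n0 <= n)%N -> rectangles X (Mn n) A.
    move: MA => [B [mB BM [n0 Bn] ->]]; exists n0 => n n0n; exists B; split => //.
      move=> i Mni; have [Mi|] := pselect (M i); last exact: BM.
      apply: Bn; rewrite leqNgt; apply: contra_notN Mni => ?.
      by split => //; exact: leq_trans n0n.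
    by exists n0.
  apply/eqP; rewrite -sqrf_eq0 eq_le sqr_ge0 andbT; apply/ler_addgt0Pr => r r0.
  rewrite add0r; have [N HN] := TS _ r0.
  pose n := maxn N n0.
  have mAM G : measurable_wrt (coord_gen X G) (\1_A : Omega -> R) -> ip (T G) \1_A = ip F \1_A.
    by move=> mG; exact: ip_cond_exp_coord.
  have -> : ip (fun w => T M w - S w) \1_A = ip (fun w => T (Mn n) w - S w) \1_A.
    rewrite !ipBl// !mAM//; apply: measurable_wrt_indic; apply: sub_rectangles_coord_gen => //.
    by apply: An0; exact: leq_maxr.
  rewrite (le_trans (cauchy_schwarz (LTnS n) LA))//.
  apply: (@le_trans _ _ (r * 1)); last by rewrite mulr1.
  apply: ler_pM; try exact: ip_ge0.
    by apply/ltW/HN; exact: leq_maxl.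
  rewrite (@eq_ip_mul _ _ _ _ _ _ (cst 1) \1_A); last first.
    by move=> w; rewrite indicE; case: (w \in A); rewrite ?mulr1 ?mulr0.
  rewrite ip1_indic// -lee_fin fineK ?fin_num_measure//; exact: probability_le1.
have [N HN] := TS _ (divr_gt0 e0 (ltr0Sn _ 1)).
exists N => n Nn; rewrite -ip_sqr_cond_expB//.
rewrite (eq_ip_sqr P (F' := fun w => (T M w - S w) - (T (Mn n) w - S w))); last first.
  by move=> w; rewrite opprB addrA subrK.
have := ip_ge0 P (fun w => (T M w - S w) + (T (Mn n) w - S w)).
by rewrite (ip_sqrD LTS (LTnS n)) (ip_sqrB LTS (LTnS n)) TS0; have := HN n Nn; lra.
Qed.

Local Notation H M := (hoeffding P X F M).
Local Notation sg M K := ((-1) ^+ (#|` M| - #|` K|)).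

Implicit Types (M N K : {fset nat}).

Lemma L2_hoeffding M : L2 (H M).
Proof. by apply: L2_sum => K _; exact/L2Z/LT. Qed.

Let LH := L2_hoeffding.

Lemma ip_hoeffdingl M (Y : Omega -> R) : L2 Y ->
  ip (H M) Y = \sum_(K <- fpowerset M) sg M K * ip (T [set` K]) Y.
Proof.
move=> LY; rewrite ip_suml//; last by move=> K _; exact/L2Z/LT.
by apply: eq_bigr => K _; rewrite ipZl.
Qed.

(** The terms K and [toggle k K] cancel: K and [toggle k K] have the same
    intersection with L when k is not in L, hence the same Gram entry. *)
Lemma ip_hoeffding_T0 k M L : k \in M -> ~ L k -> ip (H M) (T L) = 0.
Proof.
move=> kM Lk; rewrite ip_hoeffdingl//; apply: (@sum_toggle0 _ k) => K.
  by rewrite !fpowersetE toggle_sub.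
rewrite fpowersetE => KM; have KM' : (toggle k K `<=` M)%fset by rewrite toggle_sub.
rewrite !signB ?fsubset_leq_card// sign_toggle (gram [set` toggle k K]) (gram [set` K]).
rewrite (_ : [set` toggle k K] `&` L = [set` K] `&` L) ?mulrN ?mulNr//.
apply/seteqP; split=> i/=; rewrite /toggle; case: ifPn => kK; rewrite !inE.
- by move=> [/andP[_ iK] Li].
- by move=> [/orP[/eqP->|]].
- by move=> [iK Li]; split => //; rewrite iK andbT; apply: contra_notN Lk => /eqP <-.
- by move=> [iK Li]; split => //; rewrite iK orbT.
Qed.

(** If k is in M but not in N, then [hoeffding N] is a combination of T_K F with k
    not in K, and F_M is orthogonal to all of these. *)
Lemma hoeffding_orthogonal M N : M != N -> ip (H M) (H N) = 0.
Proof.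
have main M' N' k : k \in M' -> k \notin N' -> ip (H M') (H N') = 0.
  move=> kM kN; rewrite ipC ip_hoeffdingl// big1_seq// => K /andP[_].
  rewrite fpowersetE => KN; rewrite ipC (@ip_hoeffding_T0 k) ?mulr0//=.
  by apply: contraNnot kN => /(fsubsetP KN).
rewrite eqEfsubset negb_and => /orP[] /fsubsetPn[k kM kN]; last rewrite ipC.
  exact: main kM kN.
exact: main kM kN.
Qed.

(** Only the term T_M F of the second factor is not orthogonal to F_M. *)
Lemma ip_sqr_hoeffding M :
  ip (H M) (H M) = \sum_(K <- fpowerset M) sg M K * q [set` K].
Proof.
rewrite [LHS]ip_hoeffdingl// (bigD1_seq M)//= ?fset_uniq ?fpowersetE//.
rewrite subnn expr0 mul1r [X in _ + X]big1_seq ?addr0; last first.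
  move=> K /andP[KM]; rewrite fpowersetE => KsM.
  have /fsubsetPn[k kM kK] : ~~ (M `<=` K)%fset.
    by apply: contra KM => MK; rewrite eqEfsubset KsM.
  by rewrite ipC (@ip_hoeffding_T0 k) ?mulr0//=; exact/negP.
rewrite ipC ip_hoeffdingl// big_seq [RHS]big_seq; apply: eq_bigr => K.
rewrite fpowersetE => KM; rewrite (gram [set` K]) setIidl// => i/=.
exact: (fsubsetP KM).
Qed.

Lemma ip_sqr_cond_exp_hoeffding M : q [set` M] = \sum_(K <- fpowerset M) ip (H K) (H K).
Proof.
rewrite -[LHS](moebius_inversion (fun K => q [set` K])).
by apply: eq_bigr => K _; rewrite ip_sqr_hoeffding.
Qed.

Context (mF : measurable_wrt (FF setT) F).

(** F is a function of all the coordinates, so it is its own projection. *)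
Lemma ip_sqr_cond_exp_setT : q setT = ip F F.
Proof. by rewrite -ip_cond_exp_self ipC (ip_cond_exp_coord LF LF mF). Qed.

Lemma ip_sqr_malliavin k : ip (malliavin_D P X F k) (malliavin_D P X F k) =
  q setT - q (~` [set k]).
Proof. by rewrite ip_sqrB// ip_cond_exp_self ip_sqr_cond_exp_setT; ring. Qed.

(** This is Pythagoras: with T_n the projection onto the first n coordinates,
    T_n F - T_(n \ {k}) F is the projection of D_k F onto these, so the squared norm
    of the difference is the difference of the squared norms. *)
Lemma ip_sqr_residual n k :
  ip (fun w => (F w - T (~` [set k]) w) - (T `I_n w - T (`I_n `&` ~` [set k]) w))
     (fun w => (F w - T (~` [set k]) w) - (T `I_n w - T (`I_n `&` ~` [set k]) w)) =
  (q setT - q (~` [set k])) - (q `I_n - q (`I_n `&` ~` [set k])).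
Proof.
have LA : L2 (fun w => F w - T (~` [set k]) w) by exact: L2B.
have LB : L2 (fun w => T `I_n w - T (`I_n `&` ~` [set k]) w) by exact: L2B.
have AB : ip (fun w => F w - T (~` [set k]) w)
    (fun w => T `I_n w - T (`I_n `&` ~` [set k]) w) =
    q `I_n - q (`I_n `&` ~` [set k]).
  rewrite ipBl// !ipBr// (ip_cond_exp_self `I_n) (ip_cond_exp_self (`I_n `&` _)).
  rewrite (gram (~` [set k])) (gram (~` [set k])).
  rewrite (setIC _ `I_n) (setIC _ (`I_n `&` _)) -setIA setIid.
  by ring.
have AA : ip (fun w => F w - T (~` [set k]) w) (fun w => F w - T (~` [set k]) w) =
  q setT - q (~` [set k]) by exact: ip_sqr_malliavin.
rewrite (ip_sqrB LA LB) AB AA ip_sqr_cond_expB//.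
by move: (q _) (q _) (q _) (q _) => x y z t; ring.
Qed.

Lemma ip_sqr_cond_exp_setD1_le n k :
  q `I_n - q (`I_n `&` ~` [set k]) <= q setT - q (~` [set k]).
Proof. by rewrite -subr_ge0 -ip_sqr_residual ip_ge0. Qed.

(** The sums over the subsets of {0, ..., n-1} and of {0, ..., n-1} \ {k} differ
    by the sets that contain k. *)
Lemma sum_hoeffding_mem n k :
  \sum_(M <- fpowerset (initial n)) (if k \in M then ip (H M) (H M) else 0) =
  q `I_n - q (`I_n `&` ~` [set k]).
Proof.
have -> : `I_n `&` ~` [set k] = [set` (initial n `\ k)%fset].
  apply/seteqP; split => i; rewrite /= !inE mem_iota/=.
    by move=> [im /eqP ik]; apply/andP.
  by move=> /andP[/eqP ik im].
rewrite -(set_initial n) !ip_sqr_cond_exp_hoeffding [X in X - _](bigID (fun M => k \in M))/=.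
rewrite -big_mkcond/= -[LHS]addr0 -addrA; congr (_ + _); apply/esym/eqP.
rewrite subr_eq0; apply/eqP; rewrite -big_filter; apply: perm_big.
apply: uniq_perm; rewrite ?filter_uniq ?fset_uniq// => M.
by rewrite mem_filter !fpowersetE fsubsetD1 andbC.
Qed.

(** The limit of [sum_hoeffding_mem] as n tends to infinity. *)
Lemma esum_hoeffding_mem k :
  (\esum_(M in [set: {fset nat}]) (if k \in M then ip (H M) (H M) else 0)%:E =
  (ip (malliavin_D P X F k) (malliavin_D P X F k))%:E)%E.
Proof.
rewrite ip_sqr_malliavin; apply: esum_exhaust => [M|n|e e0].
- by case: ifP => // _; exact: ip_ge0.
- by rewrite sum_hoeffding_mem ip_sqr_cond_exp_setD1_le.
have e20 : 0 < e / 2 by rewrite divr_gt0.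
have [n1 /(_ _ (leqnn _))] := ip_sqr_cond_exp_cvg setT e20.
rewrite setTI => h1; exists n1; rewrite sum_hoeffding_mem.
have := ip_sqr_cond_exp_le (@subIsetr _ `I_n1 (~` [set k])).
by move: h1; move: (q _) (q _) (q _) (q _) => x y z t; lra.
Qed.

(** Exchange of the sums over k and over M: the inner sum over the k in M has |M|
    equal terms. *)
Lemma nneseries_malliavin :
  (\sum_(0 <= k <oo) (ip (malliavin_D P X F k) (malliavin_D P X F k))%:E =
   \esum_(M in [set: {fset nat}]) #|` M|%:R%:E * (ip (H M) (H M))%:E)%E.
Proof.
rewrite nneseries_esumT; last by move=> k; rewrite lee_fin ip_ge0.
under eq_esum do rewrite -esum_hoeffding_mem.
have b0 (k : nat) M : (0 <= (if k \in M then ip (H M) (H M) else 0)%:E)%E.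
  by case: ifP => // _; rewrite lee_fin ip_ge0.
rewrite (@esum_esum _ _ _ setT (fun=> setT))//.
rewrite (reindex_esum (setT `*` setT) _ (fun x => (x.2, x.1))); last first.
  split => //= [[i1 i2] [j1 j2] _ _ [-> ->]//|[i j] _].
  by exists (j, i).
rewrite -(@esum_esum _ _ _ setT (fun=> setT)
  (fun M k => (if k \in M then ip (H M) (H M) else 0)%:E))//.
apply: eq_esum => M _.
transitivity (\esum_(k in [set` M]) (ip (H M) (H M))%:E)%E.
  rewrite [RHS]esum_mkcond; apply: eq_esum => k _.
  by rewrite mem_setE; case: ifP.
rewrite esum_fset//; last by move=> i _; rewrite lee_fin ip_ge0.
rewrite fsbig_finite//= set_fsetK sumEFin big_const_seq count_predT iter_addr_0.
by rewrite -EFinM mulr_natl.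
Qed.

End hoeffding_decomposition.

(** * The levels of the decomposition *)

Section hoeffding_level.
Context (R : realType) (d : nat -> measure_display)
  (E : forall n, measurableType (d n)) (mu_ : forall n, probability (E n) R)
  (mu : probability (seqspace E) R) (mu_prod : is_product_measure mu_ mu)
  dO (Omega : measurableType dO) (P : probability Omega R)
  (X : {mfun Omega >-> seqspace E})
  (X_mu : forall A, measurable A -> distribution P X A = mu A).
Context (F : Omega -> R) (LF : L2 P F).
Implicit Types (M K : {fset nat}) (J : {fset {fset nat}}).

Local Notation ip := (ip P).
Local Notation L2 := (L2 P).
Local Notation H M := (hoeffding P X F M).
Local Notation a M := (ip (H M) (H M)).

Let LH M : L2 (H M). Proof. exact: L2_hoeffding. Qed.
Let a_ge0 M : 0 <= a M. Proof. exact: ip_ge0. Qed.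
Let H_orth M N : M != N -> ip (H M) (H N) = 0.
Proof. exact: (hoeffding_orthogonal mu_prod X_mu). Qed.

Context (p : nat).

Definition level_sum J : Omega -> R :=
  fun w => \sum_(M <- J | #|` M| == p) H M w.

Local Notation S_ := level_sum.
Local Notation c J := (\sum_(M <- J | #|` M| == p) a M).

Lemma L2_level_sum J : L2 (S_ J).
Proof. by apply: L2_sum => M _. Qed.

Let LS := L2_level_sum.

Lemma ip_level_sum_hoeffding J M : M \in J -> #|` M| = p ->
  ip (S_ J) (H M) = a M.
Proof.
move=> MJ Mp; rewrite ip_suml// big_mkcond (bigD1_seq M) ?fset_uniq//= ifT; last exact/eqP.
by rewrite big1 ?addr0// => N NM; case: ifP => // _; exact: H_orth.
Qed.

Lemma ip_level_sum J J' : (J `<=` J')%fset -> ip (S_ J') (S_ J) = c J.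
Proof.
move=> JJ'; rewrite ip_sumr// big_seq_cond [RHS]big_seq_cond.
apply: eq_bigr => M /andP[MJ /eqP Mp]; apply: ip_level_sum_hoeffding => //.
exact: (fsubsetP JJ').
Qed.

Lemma ip_sqr_level_sumB J J' : (J `<=` J')%fset ->
  ip (fun w => S_ J' w - S_ J w) (fun w => S_ J' w - S_ J w) = c J' - c J.
Proof.
by move=> JJ'; rewrite ip_sqrB// !ip_level_sum//; ring.
Qed.

Lemma level_sum_le J J' : (J `<=` J')%fset -> c J <= c J'.
Proof. by move=> JJ'; rewrite -subr_ge0 -ip_sqr_level_sumB// ip_ge0. Qed.

Lemma level_sum_bounded J : c J <= ip F F.
Proof.
have [n Jn] := exhaust_fset_fset J.
rewrite (le_trans (level_sum_le Jn))//.
apply: le_trans (ip_sqr_cond_exp_le_ip X LF [set` initial n]).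
rewrite (ip_sqr_cond_exp_hoeffding mu_prod X_mu LF) [leRHS](bigID (fun M => #|` M| == p))/=.
by rewrite lerDl sumr_ge0.
Qed.

Lemma measurable_hoeffding M : measurable_wrt (coord_gen X setT) (H M).
Proof.
rewrite /hoeffding; elim: (fpowerset M : seq _) => [|K s IH].
  rewrite (_ : (fun w => _) = cst 0); first exact: measurable_wrt_cst.
  by apply/funext => w; rewrite big_nil.
rewrite (_ : (fun w => _) = (fun w => (-1) ^+ (#|` M| - #|` K|) *
    cond_exp P (coord_gen X [set` K]) F w + \sum_(L <- s)
     (-1) ^+ (#|` M| - #|` L|) * cond_exp P (coord_gen X [set` L]) F w)); last first.
  by apply/funext => w; rewrite big_cons.
apply: measurable_wrtD => //; apply: measurable_wrtZ.
have mK : measurable_wrt (coord_gen X [set` K]) (cond_exp P (coord_gen X [set` K]) F).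
  exact: measurable_cond_exp_coord.
by apply: measurable_wrtS mK; exact: coord_genS.
Qed.

Lemma measurable_level_sum J : measurable_wrt (coord_gen X setT) (S_ J).
Proof.
rewrite /level_sum; elim: (J : seq _) => [|K s IH].
  rewrite (_ : (fun w => _) = cst 0); first exact: measurable_wrt_cst.
  by apply/funext => w; rewrite big_nil.
rewrite (_ : (fun w => _) = if #|` K| == p
    then (fun w => H K w + \sum_(M <- s | #|` M| == p) H M w)
  else (fun w => \sum_(M <- s | #|` M| == p) H M w)); last first.
  by case: ifPn => Kp; apply/funext => w; rewrite big_cons ?Kp ?(negbTE Kp).
by case: ifPn => // _; apply: measurable_wrtD => //; exact: measurable_hoeffding.
Qed.

(** The partial sums of an orthogonal series are Cauchy as soon as the squared
    norms are summable.  The sums over the subsets of {0, ..., n-1} have a limit by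
    completeness, and monotonicity of the sums of squared norms extends the
    convergence to the net of all finite families. *)
Lemma is_hoeffding_level_ex : exists S, is_hoeffding_level P X F p S.
Proof.
pose Q n := fpowerset (initial n).
have Q_homo m n : (m <= n)%N -> (Q m `<=` Q n)%fset.
  by move=> mn; rewrite fpowersetS initial_sub.
have /cvgrPdist_lt c_cvg : c (Q n) @[n --> \oo] --> limn (fun n => c (Q n)).
  apply: nondecreasing_is_cvgn; first by move=> m n mn; exact/level_sum_le/Q_homo.
  by exists (ip F F) => _ [n _ <-]; exact: level_sum_bounded.
have tail (r : R) : 0 < r -> exists N, forall J, (Q N `<=` J)%fset -> c J - c (Q N) < r.
  move=> r0; have [N _ HN] := c_cvg _ (divr_gt0 r0 (ltr0Sn _ 1)).
  exists N => J NJ; have [n Jn] := exhaust_fset_fset J.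
  have := level_sum_le (fsubset_trans Jn (Q_homo n (maxn N n) (leq_maxr _ _))).
  have := HN N (leqnn _); have := HN (maxn N n) (leq_maxl _ _) => /=.
  rewrite !ltr_norml; move: (limn _) (c J) (c (Q N)) (c (Q (maxn N n))) => l x y z.
  by move=> /andP[h1 h2] /andP[h3 h4] h5; lra.
have [S [LSS mS SS]] : exists S : Omega -> R,
    [/\ L2 S,
      forall G : set (set Omega), (forall n, measurable_wrt G (S_ (Q n))) ->
        measurable_wrt G S &
      forall e, 0 < e -> exists N, forall n, (N <= n)%N ->
        ip (fun w => S_ (Q n) w - S w) (fun w => S_ (Q n) w - S w) < e].
  apply: riesz_fischer => // r r0.
  have [N' HN'] := tail (r / 2) (divr_gt0 r0 (ltr0Sn _ 1)); exists N' => m n Nm Nn.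
  have main i j : (N' <= i)%N -> (i <= j)%N ->
      ip (fun w => S_ (Q j) w - S_ (Q i) w) (fun w => S_ (Q j) w - S_ (Q i) w) < r.
    move=> Ni ij; rewrite ip_sqr_level_sumB; last exact: Q_homo.
    have := HN' _ (Q_homo _ _ (leq_trans Ni ij)).
    have := level_sum_le (Q_homo _ _ Ni).
    by move: (c _) (c _) (c _) r0 => x y z; lra.
  have [mn|nm] := leqP m n; last exact/main/ltnW.
  by rewrite ip_sqrBC; exact: main.
have {}mS : measurable_wrt (coord_gen X setT) S.
  by apply: mS => n; exact: measurable_level_sum.
exists S; split; first exact/L2_XP.
move=> e e0; have e40 : 0 < e ^+ 2 / 4 by rewrite divr_gt0 ?exprn_gt0.
have [N1 HN1] := tail _ e40; have [N2 HN2] := SS _ e40.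
exists (Q (maxn N1 N2)) => J QJ.
rewrite (Lnorm_lt e0 (L2B LSS (LS J))).
set Qn := Q (maxn N1 N2) in QJ *.
have Q1 : (Q N1 `<=` Qn)%fset := Q_homo _ _ (leq_maxl N1 N2).
have L1 : L2 (fun w => S w - S_ Qn w) by exact: L2B.
have L3 : L2 (fun w => S_ Qn w - S_ J w) by exact: L2B.
have h1 : ip (fun w => S w - S_ Qn w) (fun w => S w - S_ Qn w) < e ^+ 2 / 4.
  by rewrite ip_sqrBC; exact/HN2/leq_maxr.
have h2 : ip (fun w => S_ Qn w - S_ J w) (fun w => S_ Qn w - S_ J w) < e ^+ 2 / 4.
  rewrite ip_sqrBC ip_sqr_level_sumB//; apply: le_lt_trans (HN1 _ (fsubset_trans Q1 QJ)).
  by rewrite lerD2l lerN2 level_sum_le.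
rewrite (eq_ip_sqr P (F := fun w => S w - S_ J w)
    (F' := fun w => (S w - S_ Qn w) + (S_ Qn w - S_ J w))); last first.
  by move=> w; rewrite subrKA.
apply: le_lt_trans (ip_sqrD_le L1 L3) _.
by move: (ip _ _) (ip _ _) (e ^+ 2) h1 h2 => x y z; lra.
Qed.

(** The limit S satisfies <S, F_M> = |F_M|^2 for |M| = p, so the squared distance to
    a partial sum is |S|^2 minus the sum of the |F_M|^2; it is nonnegative and
    becomes arbitrarily small. *)
Lemma esum_hoeffding_level S : is_hoeffding_level P X F p S ->
  (\esum_(M in [set: {fset nat}]) (if #|` M| == p then a M else 0)%:E =
   (ip S S)%:E)%E.
Proof.
move=> [/L2_XP[LSS _] Slim].
have {}Slim r : 0 < r -> exists J0, forall J, (J0 `<=` J)%fset ->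
    ip (fun w => S w - S_ J w) (fun w => S w - S_ J w) < r.
  move=> r0; have sr0 : 0 < Num.sqrt r by rewrite sqrtr_gt0.
  have [J0 HJ0] := Slim _ sr0; exists J0 => J /HJ0.
  by rewrite (Lnorm_lt sr0 (L2B LSS (LS J))) sqr_sqrtr// ltW.
have SH M : #|` M| = p -> ip S (H M) = a M.
  move=> Mp; apply/eqP; rewrite -subr_eq0 -sqrf_eq0 eq_le sqr_ge0 andbT.
  apply/ler_addgt0Pr => r r0; rewrite add0r.
  (* a M may vanish, hence the denominator a M + 1 *)
  have [J0 HJ0] := Slim (r / (a M + 1)) (divr_gt0 r0 (ltr_wpDl (a_ge0 M) ltr01)).
  have MJ : M \in (M |` J0)%fset by rewrite !inE eqxx.
  rewrite -{1}(ip_level_sum_hoeffding MJ Mp) -ipBl//.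
  rewrite (le_trans (cauchy_schwarz (L2B LSS (LS _)) (LH M)))//.
  apply: (@le_trans _ _ (r / (a M + 1) * (a M + 1))); last first.
    by rewrite divfK// gt_eqF// ltr_wpDl.
  apply: ler_pM; rewrite ?ip_ge0 ?lerDl//.
  by apply/ltW/HJ0; exact: fsubsetU1.
have SS J : ip (fun w => S w - S_ J w) (fun w => S w - S_ J w) = ip S S - c J.
  rewrite ip_sqrB// ip_level_sum// (_ : ip S (S_ J) = c J); first by ring.
  by rewrite ip_sumr//; apply: eq_bigr => M /eqP; exact: SH.
apply: esum_exhaust => [M|n|e e0].
- by case: ifP.
- by rewrite -big_mkcond/= -subr_ge0 -SS ip_ge0.
have [J0 HJ0] := Slim e e0; have [n Jn] := exhaust_fset_fset J0.
exists n; rewrite -big_mkcond/=; have := HJ0 _ Jn; rewrite SS.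
by move: (ip _ _) (\sum_(_ <- _ | _) _) => x y; lra.
Qed.

(** [hoeffding_level] is some choice of the limit, and all limits have this norm. *)
Lemma ip_hoeffding_level :
  'E_P[(fun w => hoeffding_level P X F p w ^+ 2)%R]%E =
  (\esum_(M in [set M : {fset nat} | #|` M| = p]) (a M)%:E)%E.
Proof.
have lev : is_hoeffding_level P X F p (hoeffding_level P X F p).
  exact: (xgetPex (cst 0) is_hoeffding_level_ex).
rewrite expectation_sqrE; last by have [/L2_XP[]] := lev.
rewrite -(esum_hoeffding_level lev) [RHS]esum_mkcond; apply: eq_esum => M _.
by case: ifPn => /eqP h; [rewrite mem_set|rewrite memNset].
Qed.

End hoeffding_level.

(** * Resampling one coordinate *)

Section factorization.
Context (R : realType) (d : nat -> measure_display)
  (E : forall n, measurableType (d n)) dO (Omega : measurableType dO)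
  (X : {mfun Omega >-> seqspace E}).

(** For each rational q the event q < F is X^-1(B q) for some measurable B q.  Then
    f(x) = sup of the q with x in B q is measurable and f(X) = F. *)
Lemma doob_dynkin (F : Omega -> R) : measurable_wrt (coord_gen X setT) F ->
  exists2 f : seqspace E -> R, measurable_fun setT f & forall w, F w = f (X w).
Proof.
move=> mF.
have /choice[B BP] (q : rat) : exists B : set (seqspace E),
    measurable B /\ X @^-1` B = [set w | ratr q < F w].
  have : <<s coord_gen X setT >> [set w | ratr q < F w].
    have mc : measurable_wrt (coord_gen X setT) (cst (ratr q) : Omega -> R).
      exact: measurable_wrt_cst.
    have := @measurable_fun_ltr _ (g_sigma_algebraType (coord_gen X setT)) _ setT _ _ mc mF.
    move=> /(_ measurableT [set true] I); rewrite setTI.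
    by congr (<<s _ >> _); apply/seteqP.
  by rewrite coord_genT => -[B mB]; rewrite setTI => <-; exists B.
pose h (n : nat) (x : seqspace E) : \bar R :=
  if choice.unpickle n is Some q then (if x \in B q then (ratr q)%:E else -oo%E) else -oo%E.
have mh n : measurable_fun setT (h n).
  rewrite /h; case: (choice.unpickle n) => [q|]; last exact: measurable_cst.
  apply: measurable_fun_ifT => //.
  by apply: (measurable_fun_bool true); rewrite setTI [X in measurable X](_ : _ = B q);
    [exact: (BP q).1|by apply/seteqP; split => x /=; [exact: set_mem|exact: mem_set]].
(* the tail supremum from rank 0 is the supremum of the whole sequence *)
exists (fun x => fine (esups (h ^~ x) 0%N)).
  apply: (measurableT_comp (fine_measurable measurableT)).
  exact: measurable_fun_esups.
move=> w; suff -> : esups (h ^~ (X w)) 0%N = (F w)%:E by [].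
have BF q : (X w \in B q) = (ratr q < F w).
  have [_ BX] := BP q; apply/idP/idP.
    by move=> /set_mem Bq; have : (X @^-1` B q) w by []; rewrite BX.
  by move=> qF; apply: mem_set; have : [set w | ratr q < F w] w by []; rewrite -BX.
apply/eqP; rewrite eq_le; apply/andP; split.
  apply: ge_ereal_sup => _ [n _ <-]; rewrite /h.
  case: (choice.unpickle n) => [q|]; last exact: leNye.
  by rewrite BF; case: ifPn => [qF|_]; [rewrite lee_fin ltW|exact: leNye].
apply/lee_subgt0Pr => e e0.
have [q /andP[eq qF]] : exists q : rat, F w - e < ratr q < F w.
  have : F w - e < F w by rewrite ltrBlDr ltrDl.
  by move=> /rat_in_itvoo[q]; rewrite in_itv/=; exists q.
rewrite -EFinB (@le_trans _ _ (ratr q)%:E)//; first by rewrite lee_fin ltW.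
apply: ereal_sup_ubound; exists (choice.pickle q) => //=.
by rewrite /h choice.pickleK BF qF.
Qed.

End factorization.

Section resampling.
Context (R : realType) (d : nat -> measure_display)
  (E : forall n, measurableType (d n)) dO (Omega : measurableType dO)
  (X X' : {mfun Omega >-> seqspace E}) (k : nat).

Lemma resampleE w j : resample X X' k w j = if j == k then X' w j else X w j.
Proof.
by rewrite /resample; have [->|jk] := eqVneq j k; rewrite ?dfwithin// dfwithout// eq_sym.
Qed.

Lemma measurable_resample : measurable_fun setT (resample X X' k).
Proof.
apply: (@measurability _ _ _ _ _ _ (@cylinders _ E)) => // _ [_ [j _ [B mB <-]] <-].
rewrite !setTI.
have [jk|jk] := boolP (j == k).
  rewrite [X in measurable X](_ : _ = X' @^-1` ((fun x : seqspace E => x j) @^-1` B)).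
    rewrite -[X in measurable X]setTI; apply: (measurable_funP X' measurableT).
    by rewrite -[X in measurable X]setTI; exact: measurable_coord.
  by apply/seteqP; split => w /=; rewrite resampleE jk.
rewrite [X in measurable X](_ : _ = X @^-1` ((fun x : seqspace E => x j) @^-1` B)).
  rewrite -[X in measurable X]setTI; apply: (measurable_funP X measurableT).
  by rewrite -[X in measurable X]setTI; exact: measurable_coord.
by apply/seteqP; split => w /=; rewrite resampleE (negbTE jk).
Qed.

HB.instance Definition _ :=
  @isMeasurableFun.Build _ _ Omega (seqspace E) (resample X X' k) measurable_resample.

End resampling.

Section transfer.
Context (R : realType) (d : nat -> measure_display)
  (E : forall n, measurableType (d n))
  (mu : probability (seqspace E) R)
  dO (Omega : measurableType dO) (P : probability Omega R)
  (Y : {mfun Omega >-> seqspace E})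
  (Y_mu : forall A, measurable A -> distribution P Y A = mu A).
Implicit Types (f g : seqspace E -> R).

Lemma measurable_wrt_comp f : measurable_fun setT f ->
  measurable_wrt (coord_gen Y setT) (f \o Y).
Proof.
move=> mf; have : measurable_fun setT (f \o Y : Omega_X Y -> R).
  move=> _ B mB; exists (f @^-1` B); last by rewrite !setTI.
  by rewrite -[X in measurable X]setTI; exact: mf.
by move=> /measurable_Omega_X.
Qed.

Lemma integral_comp f : measurable_fun setT f ->
  P.-integrable setT (fun w => (f (Y w))%:E) ->
  (\int[P]_w (f (Y w))%:E = \int[mu]_x (f x)%:E)%E.
Proof.
move=> mf fi; rewrite [RHS](eq_measure_integral (distribution P Y)); last first.
  by move=> A mA _; exact/esym/Y_mu.
rewrite (integral_pushforward (measurable_funPT Y))//; last exact/measurable_EFinP.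
Qed.

(** The law of Y is mu, so composition with Y is an isometry from L2(mu) to L2(P). *)
Lemma L2_comp f : L2 mu f -> L2 P (f \o Y).
Proof.
move=> /[dup] Lf /L2_measurable mf; apply: L2_sqr_lty.
  exact: measurableT_comp.
rewrite [ltLHS](_ : _ = \int[distribution P Y]_x (f x ^+ 2)%:E)%E; last first.
  rewrite ge0_integral_pushforward//; last 2 first.
  - exact/measurable_EFinP/measurable_funX.
  - by move=> x _; rewrite lee_fin sqr_ge0.
rewrite (eq_measure_integral mu) ?L2_lty//.
by move=> A mA _; exact: Y_mu.
Qed.

Lemma ip_comp f g : L2 mu f -> L2 mu g ->
  ip P (f \o Y) (g \o Y) = ip mu f g.
Proof.
move=> Lf Lg; congr fine; apply: (integral_comp (f := fun x => f x * g x)).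
  by apply: measurable_funM; [exact: L2_measurable Lf|exact: L2_measurable Lg].
exact: (L2_integrableM (L2_comp Lf) (L2_comp Lg)).
Qed.

End transfer.

Section coordinate_process.
Context (d : nat -> measure_display) (E : forall n, measurableType (d n)).

(** The identity of the sequence space as a random sequence: its rectangles form a
    pi-system that generates the product sigma-algebra. *)
Definition coordinate_process : seqspace E -> seqspace E := idfun.

Lemma measurable_coordinate_process : measurable_fun setT coordinate_process.
Proof. exact: measurable_id. Qed.

HB.instance Definition _ := @isMeasurableFun.Build _ _ (seqspace E) (seqspace E)
  coordinate_process measurable_coordinate_process.

End coordinate_process.

Section resample_independence.
Context (R : realType) (d : nat -> measure_display)
  (E : forall n, measurableType (d n)) (mu_ : forall n, probability (E n) R)
  (mu : probability (seqspace E) R) (mu_prod : is_product_measure mu_ mu)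
  dO (Omega : measurableType dO) (P : probability Omega R)
  (X X' : {mfun Omega >-> seqspace E}) (XX' : independent_RV P X X')
  (X_mu : forall A, measurable A -> distribution P X A = mu A)
  (X'_mu : forall A, measurable A -> distribution P X' A = mu A).
Context (k : nat).

Let Xk : {mfun Omega >-> seqspace E} := resample X X' k.

Lemma rectangle_preimage (Y : {mfun Omega >-> seqspace E}) (A : forall i, set (E i)) :
  rectangle Y A = Y @^-1` [set x | forall i, A i (x i)].
Proof. by []. Qed.

(** In the event that X^(k) is in a rectangle and X_k in B, the k-th side of the
    rectangle constrains X' and B takes its place in X. *)
Lemma probability_rectangle_resample n (A : forall i, set (E i)) B :
  (forall i, measurable (A i)) -> (forall i, (n <= i)%N -> A i = setT) ->
  measurable B ->
  P (rectangle Xk A `&` [set w | B (X w k)]) =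
  ((\prod_(i < n) mu_ i (A i)) * mu_ k B)%E.
Proof.
move=> mA An mB.
pose A1 := dfwith A k B; pose A2 := dfwith (fun=> setT) k (A k) : forall i, set (E i).
have mA1 i : measurable (A1 i) by rewrite /A1; case: dfwithP.
have mA2 i : measurable (A2 i) by rewrite /A2; case: dfwithP.
have -> : rectangle Xk A `&` [set w | B (X w k)] = rectangle X A1 `&` rectangle X' A2.
  apply/seteqP; split => w.
    move=> [Aw Bw]; split => i.
      rewrite /A1; case: dfwithP => // j kj.
      by have := Aw j; rewrite /Xk/= resampleE eq_sym (negbTE kj).
    rewrite /A2; case: dfwithP => //.
    by have := Aw k; rewrite /Xk/= resampleE eqxx.
  move=> [A1w A2w]; split; last by have := A1w k; rewrite /A1 dfwithin.
  move=> i; rewrite /Xk/= resampleE; have [->|ik] := eqVneq i k.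
    by have := A2w k; rewrite /A2 dfwithin.
  by have := A1w i; rewrite /A1 dfwithout// eq_sym.
rewrite !rectangle_preimage XX'; try exact: measurable_box.
rewrite -!rectangle_preimage.
pose m := maxn n k.+1.
have Am i : (m <= i)%N -> A i = setT by rewrite geq_max => /andP[/An].
have A1m i : (m <= i)%N -> A1 i = setT.
  move=> mi; rewrite /A1 dfwithout; first exact: Am.
  by rewrite ltn_eqF//; exact: leq_trans (leq_maxr n k.+1) mi.
have A2m i : (m <= i)%N -> A2 i = setT.
  move=> mi; rewrite /A2 dfwithout//.
  by rewrite ltn_eqF//; exact: leq_trans (leq_maxr n k.+1) mi.
rewrite (probability_rectangle mu_prod X_mu mA1 A1m).
rewrite (probability_rectangle mu_prod X'_mu mA2 A2m).
have -> : (\prod_(i < n) mu_ i (A i) = \prod_(i < m) mu_ i (A i))%E.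
  rewrite -(probability_rectangle mu_prod X_mu mA An).
  by rewrite -(probability_rectangle mu_prod X_mu mA Am).
have km : (k < m)%N by exact: leq_maxr.
pose k' := Ordinal km.
rewrite (bigD1 k')//= [X in (_ * X = _)%E](bigD1 k')//= [in RHS](bigD1 k')//=.
rewrite {1}/A1 {1}/A2 !dfwithin [X in (_ * (_ * X))%E]big1 ?mule1; last first.
  move=> i ik; rewrite /A2 dfwithout ?probability_setT// eq_sym.
  by apply: contra ik => /eqP ik; apply/eqP/val_inj.
rewrite (eq_bigr (fun i : 'I_m => mu_ i (A i))); last first.
  move=> i ik; rewrite /A1 dfwithout// eq_sym.
  by apply: contra ik => /eqP ik; apply/eqP/val_inj.
by rewrite muleC muleA [RHS]muleC muleCA muleA.
Qed.

Lemma probability_rectangle_Xk n (A : forall i, set (E i)) :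
  (forall i, measurable (A i)) -> (forall i, (n <= i)%N -> A i = setT) ->
  P (rectangle Xk A) = (\prod_(i < n) mu_ i (A i))%E.
Proof.
move=> mA An; have := probability_rectangle_resample mA An (@measurableT _ (E k)).
by rewrite probability_setT mule1 => <-; congr (P _); rewrite setIT.
Qed.

(** X^(k) has the law mu of X, because both give the same probability to rectangles. *)
Lemma resample_mu S : measurable S -> distribution P Xk S = mu S.
Proof.
pose idm : {mfun seqspace E >-> seqspace E} := @coordinate_process d E.
apply: (measure_unique (rectangles idm setT) (fun=> setT)).
- rewrite g_sigma_rectangles coord_genT; apply/seteqP; split => [B mB|_ [B mB <-]].
    by exists B => //; rewrite setTI.
  by rewrite setTI.
- exact: rectangles_setI_closed.
- by move=> _; exact: rectanglesT.
- by apply/seteqP; split => // x _; exists 0%N.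
- move=> _ [A [mA _ [n An] ->]].
  rewrite -[RHS]X_mu; last exact: measurable_box.
  transitivity (P (rectangle Xk A)) => //; rewrite (probability_rectangle_Xk mA An).
  by rewrite -(probability_rectangle mu_prod X_mu mA An).
- move=> _; apply: le_lt_trans (ltry 1).
  exact: (@probability_le1 _ _ _ (distribution P Xk) _ measurableT).
Qed.

(** The k-th entry of X^(k) is X'_k, and X_k is independent of it and of the other
    entries, which are those of X. *)
Lemma resample_indep A S : rectangles Xk setT A -> rectangles X [set k] S ->
  P (A `&` S) = (P A * P S)%E.
Proof.
move=> [B [mB _ [n Bn] ->]] [C [mC Ck [m Cm] ->]].
have -> : rectangle X C = [set w | C k (X w k)].
  apply/seteqP; split => w; first exact.
  move=> Cw i; have [->//|ik] := eqVneq i k.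
  by rewrite Ck//=; exact/eqP.
rewrite (probability_rectangle_resample mB Bn (mC k)) (probability_rectangle_Xk mB Bn).
congr (_ * _)%E.
have := @probability_rectangle_resample 0 (fun=> setT) _
  (fun=> measurableT) (fun _ _ => erefl) (mC k).
rewrite big_ord0 mul1e => <-; congr (P _).
by rewrite (_ : rectangle _ _ = setT) ?setTI//; apply/seteqP.
Qed.

Context (F : Omega -> R) (LF : L2 P F) (mF : measurable_wrt (coord_gen X setT) F).
Context (f : seqspace E -> R) (Lf : L2 mu f)
  (fF : {ae P, forall w, F w = f (X w)}).

Local Notation ip := (ip P).
Local Notation Fk := (cond_exp P (coord_gen X (~` [set k])) F).

Let LfX : L2 P (f \o X). Proof. exact: L2_comp X_mu _ Lf. Qed.
Let LfXk : L2 P (f \o Xk). Proof. exact: L2_comp resample_mu _ Lf. Qed.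

Let ip_fX V : measurable_fun setT V -> ip (f \o X) V = ip F V.
Proof.
move=> mV; apply/esym/eq_ip_ae => //.
- exact: L2_measurable LF.
- exact: L2_measurable LfX.
- exact: aeW.
Qed.

(** Split a rectangle into a side on X_k and an event S1 on the other coordinates.
    On the left the side factors out because X_k is independent of X^(k), on the right
    because it is independent of the other coordinates; the remaining integrals
    over S1 agree because S1 is the same event for X and X^(k), which have the same
    law.  So E[F | X_j, j <> k] is a version of E[f(X^(k)) | X]. *)
Lemma ip_resample V : L2 P V -> measurable_wrt (coord_gen X setT) V ->
  ip (f \o Xk) V = ip Fk V.
Proof.
move=> LV mV; have LFk : L2 P Fk by exact: L2_cond_exp_coord.
have mFk : measurable_wrt (coord_gen X (~` [set k])) Fk by exact: measurable_cond_exp_coord.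
apply/eqP; rewrite -subr_eq0 -ipBl//; apply/eqP.
apply: (orthogonal_rectangles (L2B LfXk LFk) _ LV mV) => S.
move=> /(rectangles_split (~` [set k]))[S1 [S2 []]].
rewrite setIT setTD setCK => RS1 RS2 ->.
have mS1 := rectangles_measurable RS1; have mS2 := rectangles_measurable RS2.
have LS1 := L2_indic P mS1.
have [C mC [S1X S1Xk]] : exists2 C : set (seqspace E), measurable C &
    S1 = X @^-1` C /\ S1 = Xk @^-1` C.
  move: RS1 => [A [mA Ak _ ->]].
  exists [set x | forall i, A i (x i)]; first exact: measurable_box.
  split=> //; apply/seteqP; split => w Aw i.
    rewrite /Xk/= resampleE; case: eqVneq => ik; last exact: Aw.
    by rewrite Ak// => /(_ ik).
  have := Aw i; rewrite /Xk/= resampleE; case: eqVneq => ik //.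
  by rewrite Ak// => /(_ ik).
have LfC : L2 mu (fun x => f x * \1_C x) by exact: L2_mul_indic.
have mfC := L2_measurable LfC.
have kk i : (~` [set k]) i -> ~ [set k] i by [].
rewrite ipBl//; last by apply: L2_indic; exact: measurableI.
rewrite (@eq_ip_mul _ _ _ P (f \o Xk) _ ((fun x => f x * \1_C x) \o Xk) \1_S2); last first.
  by move=> w; rewrite indicI S1Xk mulrA.
rewrite (@eq_ip_mul _ _ _ P Fk _ (fun w => Fk w * \1_S1 w) \1_S2); last first.
  by move=> w; rewrite indicI mulrA.
rewrite (ip_indep_indic (Y := fun w => Fk w * \1_S1 w) mu_prod X_mu kk _ _ RS2); last 2 first.
- exact: L2_mul_indic.
- apply: measurable_wrtM => //; apply: measurable_wrt_indic.
  exact: sub_rectangles_coord_gen.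
rewrite (ip_indep_rectangles (X := Xk) (M := setT)); last 4 first.
- exact: mS2.
- by move=> A RA; exact: resample_indep.
- exact: L2_comp resample_mu _ LfC.
- exact: measurable_wrt_comp.
rewrite -mulrBr; apply/eqP; rewrite mulf_eq0; apply/orP; right; rewrite subr_eq0; apply/eqP.
rewrite -[X in ip _ X](_ : cst 1 \o Xk = _)// (ip_comp resample_mu LfC (L2_cst mu 1)).
rewrite -(ip_comp X_mu LfC (L2_cst mu 1)).
rewrite (@eq_ip_mul _ _ _ P _ _ (f \o X) \1_S1); last first.
  by move=> w; rewrite /= mulr1 S1X.
rewrite (@eq_ip_mul _ _ _ P (fun w => Fk w * \1_S1 w) _ Fk \1_S1); last first.
  by move=> w; rewrite /= mulr1.
have mS1k : measurable_wrt (coord_gen X (~` [set k])) (\1_S1 : Omega -> R).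
  by apply: measurable_wrt_indic; exact: sub_rectangles_coord_gen.
by rewrite (ip_fX (measurable_indic mS1)) (ip_cond_exp_coord LF LS1 mS1k).
Qed.

(** Expand the square: f(X^(k)) and f(X) have the norm of F, and their inner
    product is |E[F | X_j, j <> k]|^2 = |F|^2 - |D_k F|^2. *)
Lemma ip_sqr_resample :
  ip (fun w => f (Xk w) - f (X w)) (fun w => f (Xk w) - f (X w)) =
  2 * ip (malliavin_D P X F k) (malliavin_D P X F k).
Proof.
have LFk : L2 P Fk by exact: L2_cond_exp_coord.
have mfX : measurable_wrt (coord_gen X setT) (f \o X).
  by apply: measurable_wrt_comp; exact: L2_measurable Lf.
rewrite (ip_sqrB LfXk LfX) (ip_resample LfX mfX).
rewrite (ip_comp resample_mu Lf Lf) -(ip_comp X_mu Lf Lf).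
rewrite (ip_fX (L2_measurable LfX)) (ipC P F) (ip_fX (L2_measurable LF)).
rewrite (ipC P Fk) (ip_fX (L2_measurable LFk)).
rewrite (ip_sqr_malliavin LF mF) (@ip_cond_exp_self _ _ _ _ _ P X F LF).
rewrite (ip_sqr_cond_exp_setT LF mF).
by ring.
Qed.

End resample_independence.

(** * The Malliavin derivative and its domain *)

Section malliavin.
Context (R : realType) (d : nat -> measure_display)
  (E : forall n, measurableType (d n)) (mu_ : forall n, probability (E n) R)
  (mu : probability (seqspace E) R) (mu_prod : is_product_measure mu_ mu)
  dO (Omega : measurableType dO) (P : probability Omega R)
  (X : {mfun Omega >-> seqspace E})
  (X_mu : forall A, measurable A -> distribution P X A = mu A).
Implicit Types (F G : Omega -> R) (M L : set nat).

Local Notation ip := (ip P).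
Local Notation L2 := (L2 P).
Local Notation FF := (coord_gen X).
Local Notation T M F := (cond_exp P (coord_gen X M) F).
Local Notation D F k := (malliavin_D P X F k).

Lemma ae_eq_weak M (A B : Omega -> R) : L2 A -> L2 B ->
  measurable_wrt (FF M) A -> measurable_wrt (FF M) B ->
  (forall V, L2 V -> measurable_wrt (FF M) V -> ip A V = ip B V) ->
  {ae P, forall w, A w = B w}.
Proof.
move=> LA LB mA mB AB; have LAB := L2B LA LB; have mAB := measurable_wrtB mA mB.
have /(ip0_ae LAB) : ip (fun w => A w - B w) (fun w => A w - B w) = 0.
  by rewrite [LHS]ipBl// AB// subrr.
by apply: filterS => w /subr0_eq.
Qed.

(** The relation T_M T_L = T_(L /\ M) as an almost sure identity, needed because
    [malliavin_D] is computed from the chosen versions. *)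
Lemma cond_exp_tower L M F : L2 F ->
  {ae P, forall w, T M (T L F) w = T (L `&` M) F w}.
Proof.
move=> LF; set K := L `&` M; set Y := T L F.
have LY : L2 Y by exact: L2_cond_exp_coord.
have mY : measurable_wrt (FF L) Y by exact: measurable_cond_exp_coord.
have LKF : L2 (T K F) by exact: L2_cond_exp_coord.
have mKF : measurable_wrt (FF K) (T K F) by exact: measurable_cond_exp_coord.
have LKY : L2 (T K Y) by exact: L2_cond_exp_coord.
have mKY : measurable_wrt (FF K) (T K Y) by exact: measurable_cond_exp_coord.
have LMY : L2 (T M Y) by exact: L2_cond_exp_coord.
have mMY : measurable_wrt (FF M) (T M Y) by exact: measurable_cond_exp_coord.
have sKL : <<s FF K >> `<=` <<s FF L >> by apply: coord_genS; exact: subIsetl.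
have sKM : <<s FF K >> `<=` <<s FF M >> by apply: coord_genS; exact: subIsetr.
have KYF : {ae P, forall w, T K Y w = T K F w}.
  apply: (ae_eq_weak LKY LKF mKY mKF) => V LV mV; have mVL := measurable_wrtS sKL mV.
  rewrite (ip_cond_exp_coord LY LV mV) (ip_cond_exp_coord LF LV mV).
  by rewrite (ip_cond_exp_coord LF LV mVL).
apply: (ae_eq_weak LMY LKF mMY (measurable_wrtS sKM mKF)) => V LV mV.
rewrite (ip_cond_exp_coord LY LV mV) -(cond_exp_commute mu_prod X_mu LY mY LV mV) -/K.
apply: eq_ip_ae => //.
- exact: L2_measurable LKY.
- exact: L2_measurable LKF.
- exact: L2_measurable LV.
- exact: L2_measurable LV.
- exact: aeW.
Qed.

Lemma L2_malliavin F k : L2 F -> L2 (D F k).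
Proof. by move=> LF; apply: L2B => //; exact: L2_cond_exp_coord. Qed.

Lemma measurable_malliavin F k : L2 F -> measurable_wrt (FF setT) F ->
  measurable_wrt (FF setT) (D F k).
Proof.
move=> LF mF; apply: measurable_wrtB => //.
have mT : measurable_wrt (FF (~` [set k])) (T (~` [set k]) F) by exact: measurable_cond_exp_coord.
by apply: measurable_wrtS mT; exact: coord_genS.
Qed.

(** Up to null sets D_k is a linear orthogonal projection, so it does not increase
    distances. *)
Lemma ip_malliavinB_le F G k : L2 F -> L2 G ->
  ip (fun w => D F k w - D G k w) (fun w => D F k w - D G k w) <=
  ip (fun w => F w - G w) (fun w => F w - G w).
Proof.
move=> LF LG; set M := ~` [set k].
have LTF : L2 (T M F) by exact: L2_cond_exp_coord.
have LTG : L2 (T M G) by exact: L2_cond_exp_coord.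
have mTF : measurable_wrt (FF M) (T M F) by exact: measurable_cond_exp_coord.
have mTG : measurable_wrt (FF M) (T M G) by exact: measurable_cond_exp_coord.
have LV := L2B LF LG; have LW := L2B LTF LTG.
have mW := measurable_wrtB mTF mTG.
have VW : ip (fun w => F w - G w) (fun w => T M F w - T M G w) =
    ip (fun w => T M F w - T M G w) (fun w => T M F w - T M G w).
  by rewrite ipBl// [RHS]ipBl// (ip_cond_exp_coord LF LW mW) (ip_cond_exp_coord LG LW mW).
rewrite (eq_ip_sqr P (F' := fun w => (F w - G w) - (T M F w - T M G w))); last first.
  by move=> w; rewrite /malliavin_D -/M; ring.
rewrite (ip_sqrB LV LW) VW; have := ip_ge0 P (fun w => T M F w - T M G w).
by move: (ip _ _) (ip _ _) => x y; lra.
Qed.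

Lemma ip_sqr_malliavin_residual F n k : L2 F -> measurable_wrt (FF setT) F ->
  ip (fun w => D F k w - D (T `I_n F) k w) (fun w => D F k w - D (T `I_n F) k w) =
  ip (D F k) (D F k) - (ip (T `I_n F) (T `I_n F) -
    ip (T (`I_n `&` ~` [set k]) F) (T (`I_n `&` ~` [set k]) F)).
Proof.
move=> LF mF; rewrite (ip_sqr_malliavin LF mF) -(ip_sqr_residual mu_prod X_mu LF mF).
have LT M : L2 (T M F) by exact: L2_cond_exp_coord.
have mT M : measurable_fun setT (T M F) by exact: L2_measurable (LT M).
have mTT M : measurable_fun setT (T M (T `I_n F)).
  by apply: (@L2_measurable _ _ _ P); exact: L2_cond_exp_coord.
have mF' := L2_measurable LF.
have ae1 : {ae P, forall w, D F k w - D (T `I_n F) k w =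
    (F w - T (~` [set k]) F w) - (T `I_n F w - T (`I_n `&` ~` [set k]) F w)}.
  by apply: filterS (cond_exp_tower `I_n (~` [set k]) LF) => w <-.
by apply: eq_ip_ae => //; do ?[apply: measurable_funB => //].
Qed.

(** The tail of the series beyond N is small by summability.  Each of the first N
    terms |D_k F - D_k T_n F|^2 is at most |F|^2 - |T_n F|^2, a bound that does not
    depend on k and tends to 0 as n tends to infinity. *)
Lemma nneseries_malliavin_approx F e : L2 F -> measurable_wrt (FF setT) F -> 0 < e ->
  (\sum_(0 <= k <oo) (ip (D F k) (D F k))%:E < +oo)%E ->
  exists n, ip (fun w => F w - T `I_n F w) (fun w => F w - T `I_n F w) < e /\
   (\sum_(0 <= k <oo) (ip (fun w => D F k w - D (T `I_n F) k w)
       (fun w => D F k w - D (T `I_n F) k w))%:E < e%:E)%E.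
Proof.
move=> LF mF e0 Doo.
have e20 : 0 < e / 2 by rewrite divr_gt0.
have D0 k : (0 <= (ip (D F k) (D F k))%:E)%E by rewrite lee_fin ip_ge0.
have [N NS] : exists N, (\sum_(N <= k <oo) (ip (D F k) (D F k))%:E < (e / 2)%:E)%E.
  have /fine_cvgP[] := nneseries_tail_cvg Doo (fun k _ => D0 k).
  move=> [N1 _ fN1] /cvgrPdist_lt/(_ _ e20)[N2 _ hN2].
  exists (maxn N1 N2); have := hN2 (maxn N1 N2) (leq_maxr _ _).
  rewrite /= sub0r normrN => h.
  rewrite -[ltLHS]fineK; last exact: (fN1 (maxn N1 N2) (leq_maxl _ _)).
  by rewrite lte_fin; apply: le_lt_trans h; exact: ler_norm.
(* N.+1 rather than N, as N may be 0 *)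
have eN : 0 < Num.min e (e / (2 * (N.+1)%:R)).
  by rewrite lt_min e0 divr_gt0// mulr_gt0.
have [n /(_ _ (leqnn _))] := ip_sqr_cond_exp_cvg mu_prod X_mu LF setT eN.
rewrite setTI lt_min => /andP[qn1 qn2].
exists n; split.
  rewrite ip_sqrB//; last exact: L2_cond_exp_coord.
  rewrite (@ip_cond_exp_self _ _ _ _ _ P X F LF) -(ip_sqr_cond_exp_setT LF mF).
  by move: qn1; move: (ip _ _) (ip _ _) => x y; lra.
pose r k := ip (fun w => D F k w - D (T `I_n F) k w)
  (fun w => D F k w - D (T `I_n F) k w).
change (\sum_(0 <= k <oo) (r k)%:E < e%:E)%E.
have r0 k : (0 <= (r k)%:E)%E by rewrite lee_fin ip_ge0.
have -> : (\sum_(0 <= k <oo) (r k)%:E =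
    \sum_(0 <= k < N) (r k)%:E + \sum_(N <= k <oo) (r k)%:E)%E.
  exact: (@nneseries_split _ _ 0%N N (fun k _ => r0 k)).
rewrite [e]splitr EFinD.
apply: lee_ltD => //; first by rewrite sumEFin.
  rewrite sumEFin lee_fin big_mkord.
  apply: (@le_trans _ _ (\sum_(i < N) e / (2 * (N.+1)%:R))).
    apply: ler_sum => i _.
    rewrite /r ip_sqr_malliavin_residual// (ip_sqr_malliavin LF mF).
    have := ip_sqr_cond_exp_le mu_prod X_mu LF (@subIsetr _ `I_n (~` [set nat_of_ord i])).
    by move: qn2; move: (ip _ _) (ip _ _) (ip _ _) (ip _ _) (e / _) => x y z t s; lra.
  rewrite big_const_ord iter_addr_0 -[leLHS]mulr_natr.
  rewrite (_ : e / _ * _ = e / 2 * (N%:R / N.+1%:R)); last first.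
    by field; rewrite addrC natr1 pnatr_eq0.
  by apply: ler_piMr; [exact: ltW|rewrite ler_pdivrMr// mul1r ler_nat].
apply: le_lt_trans NS; apply: lee_nneseries => k _ //.
rewrite lee_fin /r ip_sqr_malliavin_residual// lerBlDr lerDl subr_ge0.
by apply: (ip_sqr_cond_exp_le mu_prod X_mu LF); exact: subIsetl.
Qed.

End malliavin.

Section equivalences.
Context (R : realType) (d : nat -> measure_display)
  (E : forall n, measurableType (d n)) (mu_ : forall n, probability (E n) R)
  (mu : probability (seqspace E) R) (mu_prod : is_product_measure mu_ mu)
  dO (Omega : measurableType dO) (P : probability Omega R)
  (X X' : {mfun Omega >-> seqspace E}) (XX' : independent_RV P X X')
  (X_mu : forall A, measurable A -> distribution P X A = mu A)
  (X'_mu : forall A, measurable A -> distribution P X' A = mu A)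
  (F : Omega -> R) (LF : L2 P F) (mF : measurable_wrt (coord_gen X setT) F).

Local Notation ip := (ip P).
Local Notation L2 := (L2 P).
Local Notation D F k := (malliavin_D P X F k).
Local Notation a M := (ip (hoeffding P X F M) (hoeffding P X F M)).

Let LD k : L2 (D F k). Proof. exact: L2_malliavin. Qed.
Let mD k : measurable_wrt (coord_gen X setT) (D F k).
Proof. exact: measurable_malliavin. Qed.

Let energy := (\sum_(0 <= k <oo) (ip (D F k) (D F k))%:E)%E.

Lemma L2_kappaP_malliavin :
  L2_kappaP P X (malliavin_D P X F) <-> (energy < +oo)%E.
Proof.
rewrite L2_kappaPP (eq_eseriesr (g := fun k => (ip (D F k) (D F k))%:E)).
  by split=> [[]//|].
by move=> k _; rewrite ip_sqrE.
Qed.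

Lemma energy_expectation :
  (\sum_(0 <= k <oo) 'E_P[(fun w => malliavin_D P X F k w ^+ 2)%R])%E = energy.
Proof. by apply: eq_eseriesr => k _; rewrite expectation_sqrE. Qed.

Lemma energy_hoeffding : energy =
  (\esum_(M in [set: {fset nat}])
     #|` M|%:R%:E * 'E_P[(fun w => hoeffding P X F M w ^+ 2)%R])%E.
Proof.
rewrite /energy (nneseries_malliavin mu_prod X_mu LF mF).
by apply: eq_esum => M _; rewrite expectation_sqrE//; exact: L2_hoeffding.
Qed.

(** The function given by [doob_dynkin] is square integrable by change of variables. *)
Lemma is_representative_ex : exists f, is_representative P X mu F f.
Proof.
have [f mf Ff] := doob_dynkin mF; exists f; split; last exact: aeW.
apply: L2_sqr_lty => //.
have := L2_lty LF; congr (_ < _)%E.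
rewrite (eq_integral (fun w => (f (X w) ^+ 2)%:E)); last by move=> w _; rewrite Ff.
apply: (integral_comp X_mu (f := fun x => f x ^+ 2)); first exact: measurable_funX.
by have := Lfun2_integrable_sqr LF; apply: eq_integrable => // w _ /=; rewrite Ff.
Qed.

Lemma energy_resample f : is_representative P X mu F f ->
  (\sum_(0 <= k <oo)
     'E_P[(fun w => (f (resample X X' k w) - f (X w)) ^+ 2)%R] = 2%:E * energy)%E.
Proof.
move=> [Lf fF]; rewrite -nneseriesZl//; last by move=> k _; rewrite lee_fin ip_ge0.
apply: eq_eseriesr => k _; rewrite expectation_sqrE.
  by rewrite (ip_sqr_resample mu_prod XX' X_mu X'_mu k LF mF Lf fF).
apply: L2B; last exact: (L2_comp X_mu Lf).
exact: (L2_comp (resample_mu mu_prod XX' X_mu X'_mu k) Lf).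
Qed.

Lemma two_energy_lty : (2%:E * energy < +oo)%E <-> (energy < +oo)%E.
Proof.
have : (0 <= energy)%E by apply: nneseries_ge0 => k _ _; rewrite lee_fin ip_ge0.
case: energy => [r| |]// _; first by rewrite -EFinM !ltry.
by rewrite gt0_muley ?lte_fin.
Qed.

Lemma mule_esum (I : choiceType) (S : set I) (b : I -> \bar R) (p : nat) :
  (forall M, 0 <= b M)%E ->
  (p%:R%:E * (\esum_(M in S) b M) = \esum_(M in S) (p%:R%:E * b M))%E.
Proof.
(* multiplication by p is a finite sum, and finite sums commute with esum *)
move=> b0; transitivity (\esum_(M in S) \sum_(0 <= i < p) b M)%E.
  by rewrite esum_sum// sumr_const_nat subn0 mule_natl.
by apply: eq_esum => M _; rewrite sumr_const_nat subn0 mule_natl.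
Qed.

Lemma level_energy :
  (\sum_(1 <= p <oo) p%:R%:E * 'E_P[(fun w => hoeffding_level P X F p w ^+ 2)%R] =
   \esum_(M in [set: {fset nat}])
     #|` M|%:R%:E * 'E_P[(fun w => hoeffding P X F M w ^+ 2)%R])%E.
Proof.
have b0 M : (0 <= 'E_P[(fun w => hoeffding P X F M w ^+ 2)%R])%E.
  by apply: expectation_ge0 => w; exact: sqr_ge0.
have lev p : (p%:R%:E * 'E_P[(fun w => hoeffding_level P X F p w ^+ 2)%R] =
    \esum_(M in [set M : {fset nat} | #|` M| = p])
      #|` M|%:R%:E * 'E_P[(fun w => hoeffding P X F M w ^+ 2)%R])%E.
  rewrite (ip_hoeffding_level mu_prod X_mu LF) mule_esum; last first.
    by move=> M; rewrite lee_fin ip_ge0.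
  by apply: eq_esum => M <-; rewrite expectation_sqrE//; exact: L2_hoeffding.
rewrite (_ : [set: {fset nat}] = \bigcup_p [set M : {fset nat} | #|` M| = p]); last first.
  by apply/seteqP; split => // M _; exists #|` M|.
rewrite nneseries_sum_bigcup; last 2 first.
- by move=> i j _ _ [M [<- <-]].
- by move=> M; rewrite mule_ge0// lee_fin.
under [RHS]eq_eseriesr do rewrite -lev.
rewrite [RHS](@nneseries_split _ _ 0%N 1%N); last first.
  by move=> k _; rewrite mule_ge0 ?lee_fin//; apply: expectation_ge0 => w; exact: sqr_ge0.
by rewrite big_nat1 mul0e add0e.
Qed.

(** The approximating cylindrical variables are G = E[F | X_0, ..., X_(n-1)]. *)
Lemma energy_dom_D : (energy < +oo)%E -> dom_D P X F.
Proof.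
move=> Eoo; exists (malliavin_D P X F); split.
- exact/L2_XP.
- exact/L2_kappaP_malliavin.
move=> e e0.
have [n [Fn Dn]] := nneseries_malliavin_approx mu_prod X_mu LF mF (exprn_gt0 2 e0) Eoo.
pose G := cond_exp P (coord_gen X `I_n) F.
have LG : L2 G by exact: L2_cond_exp_coord.
have mGn : measurable_wrt (coord_gen X `I_n) G by exact: measurable_cond_exp_coord.
have mG : measurable_wrt (coord_gen X setT) G.
  by apply: measurable_wrtS mGn; exact: coord_genS.
exists G; split.
- by split; [exact/L2_XP|exists n].
- by rewrite Lnorm_P_X_lt//; [exact: L2B|exact: measurable_wrtB].
have mDG k : measurable_wrt (coord_gen X setT) (fun w => D F k w - D G k w).
  by apply: measurable_wrtB => //; exact: measurable_malliavin.
rewrite (Lnorm_kappaP_lt P e0 mDG); move: Dn; congr (_ < _)%E.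
apply: eq_eseriesr => k _; rewrite ip_sqrE//.
by apply: L2B => //; exact: L2_malliavin.
Qed.

(** If U is a limit of D G with G tending to F, then [D F k = U k] almost surely for
    every k, as D_k does not increase distances. *)
Lemma dom_D_energy : dom_D P X F -> (energy < +oo)%E.
Proof.
move=> [U [_ /L2_kappaPP[mU Uoo] Uapp]].
have LU k : L2 (U k).
  apply: L2_sqr_lty.
    by apply: measurable_wrt_measurable (mU k); exact: coord_gen_measurable.
  apply: le_lt_trans Uoo.
  have U0 j : (0 <= \int[P]_w (U j w ^+ 2)%:E)%E.
    by apply: integral_ge0 => w _; rewrite lee_fin sqr_ge0.
  apply: le_trans (nneseries_lim_ge k.+1 (fun n _ _ => U0 n)).
  by rewrite big_nat_recr//= leeDr// sume_ge0.
suff DU k : {ae P, forall w, D F k w = U k w}.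
  move: Uoo; congr (_ < _)%E; apply: eq_eseriesr => k _; rewrite ip_sqrE//.
  congr EFin; apply/esym/eq_ip_ae => //; exact: L2_measurable.
have LDU := L2B (LD k) (LU k).
suff /(ip0_ae LDU) : ip (fun w => D F k w - U k w) (fun w => D F k w - U k w) = 0.
  by apply: filterS => w /subr0_eq.
apply/eqP; rewrite eq_le ip_ge0 andbT; apply/ler_addgt0Pr => e e0; rewrite add0r.
(* two squared distances below e / 4, each doubled by [ip_sqrD_le] *)
pose s := Num.sqrt (e / 4).
have s0 : 0 < s by rewrite sqrtr_gt0 divr_gt0.
have s2 : s ^+ 2 = e / 4 by rewrite sqr_sqrtr// divr_ge0// ltW.
have [G [[/L2_XP[LG mG] _] FG UG]] := Uapp s s0.
have LDG j : L2 (D G j) by exact: L2_malliavin.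
have mDG j : measurable_wrt (coord_gen X setT) (D G j) by exact: measurable_malliavin.
have mUG j : measurable_wrt (coord_gen X setT) (fun w => U j w - D G j w).
  exact: measurable_wrtB.
rewrite Lnorm_P_X_lt// in FG; [|exact: L2B|exact: measurable_wrtB].
rewrite (Lnorm_kappaP_lt P s0 mUG) in UG.
have {}UG : ip (fun w => U k w - D G k w) (fun w => U k w - D G k w) < s ^+ 2.
  rewrite -lte_fin -ip_sqrE; last exact: L2B.
  apply: le_lt_trans UG.
  have U0 j : (0 <= \int[P]_w ((U j w - D G j w) ^+ 2)%:E)%E.
    by apply: integral_ge0 => w _; rewrite lee_fin sqr_ge0.
  apply: le_trans (nneseries_lim_ge k.+1 (fun n _ _ => U0 n)).
  by rewrite big_nat_recr//= leeDr// sume_ge0.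
have {}FG := le_lt_trans (ip_malliavinB_le X k LF LG) FG.
rewrite (eq_ip_sqr P (F' := fun w => (D F k w - D G k w) + (D G k w - U k w))); last first.
  by move=> w; rewrite subrKA.
apply: le_trans (ip_sqrD_le (L2B (LD k) (LDG k)) (L2B (LDG k) (LU k))) _.
move: UG FG; rewrite ip_sqrBC s2; move: (ip _ _) (ip _ _) => x y; lra.
Qed.

End equivalences.

Theorem proposition2p5 (R : realType) (d : nat -> measure_display)
    (E : forall n, measurableType (d n)) (mu_ : forall n, probability (E n) R)
    (mu : probability (seqspace E) R) (mu_prod : is_product_measure mu_ mu)
    (dO : measure_display) (Omega : measurableType dO)
    (P : probability Omega R) (X X' : {mfun Omega >-> seqspace E})
    (XX'_indep : independent_RV P X X')
    (X_mu : forall A, measurable A -> distribution P X A = mu A)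
    (X'_mu : forall A, measurable A -> distribution P X' A = mu A)
    (F : Omega -> R) (F_L2 : L2_X P X F) :
  [<-> (* (i) *)
       dom_D P X F;
       (* (ii) *)
       L2_kappaP P X (malliavin_D P X F);
       (\sum_(0 <= k <oo) 'E_P[(fun w => malliavin_D P X F k w ^+ 2)%R] < +oo)%E;
       (* (iii) *)
       exists2 f : seqspace E -> R, is_representative P X mu F f &
         (\sum_(0 <= k <oo)
            'E_P[(fun w => (f (resample X X' k w) - f (X w)) ^+ 2)%R] < +oo)%E;
       forall f : seqspace E -> R, is_representative P X mu F f ->
         (\sum_(0 <= k <oo)
            'E_P[(fun w => (f (resample X X' k w) - f (X w)) ^+ 2)%R] < +oo)%E;
       (* (iv) *)
       (\sum_(1 <= p <oo)
            p%:R%:E * 'E_P[(fun w => hoeffding_level P X F p w ^+ 2)%R] =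
          \esum_(M in [set: {fset nat}])
            #|` M|%:R%:E * 'E_P[(fun w => hoeffding P X F M w ^+ 2)%R])%E /\
       (\esum_(M in [set: {fset nat}])
            #|` M|%:R%:E * 'E_P[(fun w => hoeffding P X F M w ^+ 2)%R] < +oo)%E].
Proof.
have [LF mF] := (L2_XP _ _ _).1 F_L2.
tfae.
- by move=> /(dom_D_energy LF mF) ?; exact/L2_kappaP_malliavin.
- by move=> /(L2_kappaP_malliavin LF mF); rewrite energy_expectation.
- rewrite energy_expectation// => Eoo.
  have [f fF] := is_representative_ex X_mu LF mF; exists f => //.
  by rewrite (energy_resample mu_prod XX'_indep X_mu X'_mu LF mF fF); exact/two_energy_lty.
- move=> [f fF]; rewrite (energy_resample mu_prod XX'_indep X_mu X'_mu LF mF fF) => Eoo g gF.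
  by rewrite (energy_resample mu_prod XX'_indep X_mu X'_mu LF mF gF).
- have [f fF] := is_representative_ex X_mu LF mF => /(_ f fF).
  rewrite (energy_resample mu_prod XX'_indep X_mu X'_mu LF mF fF).
  move=> /two_energy_lty Eoo; split; first exact: (level_energy mu_prod X_mu LF).
  by rewrite -(energy_hoeffding mu_prod X_mu LF mF).
- move=> [_]; rewrite -(energy_hoeffding mu_prod X_mu LF mF).
  exact: (energy_dom_D mu_prod X_mu LF mF).
Qed.
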